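(* Let $\alpha:[0,1]\to\mathcal{P}(S)$ be a continuous function, where $\mathcal{P}(S)$ is endowed with the topology of weak convergence. Let $X_\mu, X_\nu\in L^0(\Omega,S)$ be random variables such that $law(X_\mu)=\alpha(0)$ and $law(X_\nu)=\alpha(1)$. Then there is a continuous map $\hat\alpha:[0,1]\to L^0(\Omega,S)$, where $L^0(\Omega,S)$ is endowed with the topology of convergence in probability, such that $\hat\alpha(0)=X_\mu$, $\hat\alpha(1)=X_\nu$, and $law(\hat\alpha(t))=\alpha(t)$ for all $t\in[0,1]$.
   Context: $(S,d)$ is a complete separable metric space and $(\Omega,\mathcal{F},P)$ is a complete nonatomic probability space. $\mathcal{P}(S)$ is the set of probability measures on the Borel $\sigma$-algebra $\mathcal{B}(S)$. $L^0(\Omega,S)$ is the space of $S$-valued random variables on $\Omega$ (random variables that are equal almost surely are identified); the topology of convergence in probability is the one given by the metric $\rho(X,Y)=\inf\{\epsilon>0: P\{\omega: d(X(\omega),Y(\omega))\ge\epsilon\}\le\epsilon\}$. For $X\in L^0(\Omega,S)$, $law(X)\in\mathcal{P}(S)$ is the distribution of $X$, $law(X)(A)=P(X^{-1}(A))$. *)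

(* Defs.v *)
From HB Require Import structures.
From mathcomp Require Import all_boot all_order all_algebra.
From mathcomp Require Import all_classical all_reals all_analysis giry.
From mathcomp Require Import lra.

Set Implicit Arguments.
Unset Strict Implicit.
Unset Printing Implicit Defensive.
Import Order.TTheory GRing.Theory Num.Theory.
Import numFieldTopology.Exports numFieldNormedType.Exports.

Local Open Scope classical_set_scope.
Local Open Scope ring_scope.

HB.mixin Record isSeparable T & Topological T := {
  separable_dense : exists2 D : set T, countable D & dense D
}.

(* Separability is part of the structure because the metric on random variables
   below needs it: it makes [w |-> mdist (X w) (Y w)] measurable. *)
#[short(type="completeSeparableMetricType")]
HB.structure Definition CompleteSeparableMetric (K : numDomainType) :=
  {T of Complete T & Metric K T & isSeparable T}.

Definition borelType (S : ptopologicalType) :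
    measurableType (sigma_display (@open S)) := g_sigma_algebraType (@open S).

Definition nonatomic d (T : measurableType d) (R : realType)
    (P : probability T R) :=
  forall A, measurable A -> (0 < P A)%E ->
    exists B, [/\ measurable B, B `<=` A & (0 < P B < P A)%E].

Section borel_probability.
Context (R : realType) (S : completeSeparableMetricType R).

(* As elements of [probability _ _] are functions on all sets, Leibniz equality
   also compares their irrelevant values on nonmeasurable sets. Equality of
   probability measures is therefore to be stated on measurable sets
   ([measure_eq], written ≡μ). The topology below does not see these values. *)
Definition borel_probability : Type := probability (borelType S) R.

HB.instance Definition _ := Choice.copy borel_probability
  (probability (borelType S) R).

Definition bounded_continuous : Type :=
  {f : S -> R | continuous f /\ bounded_fun f}.

HB.instance Definition _ := gen_eqMixin bounded_continuous.
HB.instance Definition _ := gen_choiceMixin bounded_continuous.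

Definition expectations (mu : borel_probability) :
    {ptws bounded_continuous -> R} :=
  fun f => \int[(mu : probability (borelType S) R)]_x (sval f x).

(* The topology of weak convergence: the coarsest one for which
   [mu |-> \int[mu]_x f x] is continuous for every bounded continuous [f]. *)
HB.instance Definition _ := Topological.copy borel_probability
  (initial_topology expectations).

End borel_probability.
Arguments borel_probability : clear implicits.
Arguments expectations {R S} mu _.

Section L0.
Context d (Omega : measurableType d) (R : realType) (P : probability Omega R)
  (S : completeSeparableMetricType R).

(* Measurable maps Omega -> S modulo almost sure equality. *)
Definition L0 : Type := {mfun_ P, Omega >-> borelType S}.

HB.instance Definition _ := Choice.copy L0 {mfun_ P, Omega >-> borelType S}.

Definition representative (X : L0) : {mfun Omega >-> borelType S} := repr X.
Coercion representative : L0 >-> MeasurableFun.type.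

Definition law (X : L0) : borel_probability R S := distribution P X.

(* The metric inf {e > 0 : P (d(X, Y) >= e) <= e} of convergence in
   probability. *)
Definition dist_ge (X Y : Omega -> S) (e : R) : set Omega :=
  [set w | e <= mdist (X w) (Y w)].

Definition ky_fan_set (X Y : Omega -> S) : set R :=
  [set e | 0 < e /\ (P (dist_ge X Y e) <= e%:E)%E].

Definition ky_fan (X Y : L0) : R := inf (ky_fan_set X Y).

Lemma lawE (f : {mfun Omega >-> borelType S}) (A : set S) :
  measurable (A : set (borelType S)) ->
  law (\pi_({mfun_ P, Omega >-> borelType S})%qT f) A = P (f @^-1` A).
Proof.
move=> mA; set X := (\pi_(_) f)%qT.
have [N [mN N0 XfN]] : (X : L0) = f %[ae P].
  have /eqmodP/asboolP// : (representative X =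
    f %[mod {mfun_ P, Omega >-> borelType S}])%qT.
  by rewrite reprK.
have le (g h : {mfun Omega >-> borelType S}) :
    ~` N `<=` [set w | g w = h w] -> (P (g @^-1` A) <= P (h @^-1` A))%E.
  move=> gh; have mh : measurable (h @^-1` A) by exact: measurable_funPTI.
  have mg : measurable (g @^-1` A) by exact: measurable_funPTI.
  apply: (@le_trans _ _ (P (h @^-1` A `|` N))).
    apply: le_measure; rewrite ?inE//; first exact: measurableU.
    move=> w /= gA; have [|Nw] := pselect (N w); [by right|left].
    by rewrite -(gh _ Nw).
  by rewrite (le_trans (measureU2 _ _ _))//= N0 adde0.
have Xf : ~` N `<=` [set w | (X : L0) w = f w].
  by move=> w Nw; apply: contrapT => ne; apply/Nw/XfN => /(_ I).
apply/eqP; rewrite eq_le; apply/andP; split; apply: le => //.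
by move=> w /Xf /esym.
Qed.

Let ball_open (q : S) (r : R) : open (ball q r).
Proof.
rewrite openE => x; rewrite ballEmdist/= => qx.
apply/nbhs_ballP; exists (r - mdist q x) => /=; first by rewrite subr_gt0.
move=> y; rewrite !ballEmdist/= => xy.
by rewrite (le_lt_trans (metric_triangle q x y))// -ltrBrDl.
Qed.

Let mdist_ltP (D : set S) (x y : S) (e : R) : dense D ->
  mdist x y < e <-> exists2 q, D q &
    exists n, ball q n.+1%:R^-1 x /\ ball q (e - n.+1%:R^-1) y.
Proof.
move=> dD; split=> [xye|[q Dq [n []]]]; last first.
  rewrite !ballEmdist/= => qx qy.
  have aux (a dxy dxq dqy : R) :
      dxy <= dxq + dqy -> dxq < a -> dqy < e - a -> dxy < e by lra.
  apply: aux (metric_triangle x q y) _ qy.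
  by rewrite metric_sym.
have h0 : 0 < (e - mdist x y) / 2 by rewrite divr_gt0// subr_gt0.
have [n _ /(_ n (leqnn _))/= ninv] := near_infty_natSinv_lt (PosNum h0).
have {ninv} nxy : n.+1%:R^-1 < (e - mdist x y) / 2 := ninv.
have [q [xq Dq]] : ball x n.+1%:R^-1 `&` D !=set0.
  by apply: dD => //; exists x; exact: ballxx.
exists q => //; exists n; split; first exact: ball_sym.
move: xq; rewrite !ballEmdist/= => xq.
have aux (a dxy dqx dqy : R) :
  dqy <= dqx + dxy -> dqx < a -> a < (e - dxy) / 2 -> dqy < e - a by lra.
by apply: aux (metric_triangle q x y) _ nxy; rewrite metric_sym.
Qed.

Lemma measurable_dist_ge (X Y : {mfun Omega >-> borelType S}) (e : R) :
  measurable (dist_ge X Y e).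
Proof.
have [D cD dD] : exists2 D : set S, countable D & dense D.
  exact: separable_dense.
have mball (Z : {mfun Omega >-> borelType S}) (q : S) (r : R) :
    measurable (Z @^-1` ball q r).
  by apply: measurable_funPTI; apply: sub_sigma_algebra; exact: ball_open.
pose F (q : S) := \bigcup_n
  (X @^-1` ball q (n.+1%:R^-1) `&` Y @^-1` ball q (e - n.+1%:R^-1)).
suff -> : dist_ge X Y e = ~` \bigcup_(q in D) F q.
  apply: measurableC; rewrite bigcup_set_type.
  apply: countable_bigcupT_measurable.
    by rewrite (eq_countable (card_setT _)).
  by move=> q; apply: bigcupT_measurable => n; exact: measurableI.
rewrite -[LHS]setCK; congr (~` _); apply/seteqP; split => w.
  move=> /negP; rewrite -ltNge => /(mdist_ltP _ _ _ dD)[q Dq [n]].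
  by exists q => //; exists n.
move=> [q Dq [n _ XYq]]; apply/negP; rewrite -ltNge.
by apply/(mdist_ltP _ _ _ dD); exists q => //; exists n.
Qed.

Let ky_fan_lb (X Y : Omega -> S) : has_lbound (ky_fan_set X Y).
Proof. by exists 0 => e [/ltW]. Qed.

Let ky_fan_inf (X Y : {mfun Omega >-> borelType S}) :
  has_inf (ky_fan_set X Y).
Proof.
split; last exact: ky_fan_lb.
exists 1; split => //; apply: probability_le1; exact: measurable_dist_ge.
Qed.

Let ky_fan_ge0 (X Y : L0) : 0 <= ky_fan X Y.
Proof. by apply: lb_le_inf; [case: (ky_fan_inf X Y)|move=> e [/ltW]]. Qed.

Let ky_fanxx (X : L0) : ky_fan X X = 0.
Proof.
apply/eqP; rewrite eq_le ky_fan_ge0 andbT; apply/ler_addgt0Pl => e e0.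
rewrite addr0; apply: ge_inf; first exact: ky_fan_lb.
split => //; rewrite (_ : dist_ge _ _ _ = set0) ?measure0 ?lee_fin ?ltW//.
by apply/seteqP; split => // w; rewrite /dist_ge/= mdistxx leNgt e0.
Qed.

Let ky_fan_positivity (X Y : L0) : ky_fan X Y = 0 -> X = Y.
Proof.
move=> XY0; apply/eqP; rewrite -[X]reprK -[Y]reprK eqmodE; apply/asboolP.
have mXY := measurable_dist_ge X Y.
have dist_ge0 r : 0 < r -> P (dist_ge X Y r) = 0%E.
  move=> r0; apply/eqP; rewrite eq_le measure_ge0 andbT.
  apply/lee_addgt0Pr => e e0; rewrite add0e.
  have m0 : 0 < Num.min r e by rewrite lt_min r0.
  have [e' [e'0 Pe']] := inf_adherent m0 (ky_fan_inf X Y).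
  rewrite -/(ky_fan X Y) XY0 add0r lt_min => /andP[e'r e'e].
  apply: (@le_trans _ _ e'%:E); last by rewrite lee_fin ltW.
  apply: le_trans Pe'; apply: le_measure; rewrite ?inE//.
  by move=> w; apply: le_trans; exact: ltW.
have : P.-negligible (\bigcup_n dist_ge X Y n.+1%:R^-1).
  apply: negligible_bigcup => n; apply/negligibleP => //.
  exact: dist_ge0.
apply: negligibleS => w /= /not_implyP[_ XYw].
have XYw0 : 0 < mdist (X w : S) (Y w).
  by rewrite mdist_gt0; apply/eqP.
have [n _ /(_ n (leqnn _))/= nXY] := near_infty_natSinv_lt (PosNum XYw0).
by exists n => //; exact: ltW.
Qed.

Let ky_fan_sym (X Y : L0) : ky_fan X Y = ky_fan Y X.
Proof.
by congr (inf _); apply/funext => e; rewrite /ky_fan_set /dist_ge/=;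
  under eq_set do rewrite metric_sym.
Qed.

Let ky_fan_triangle (Y X Z : L0) : ky_fan X Z <= ky_fan X Y + ky_fan Y Z.
Proof.
apply/ler_addgt0Pl => e e0; have e20 : 0 < e / 2 by rewrite divr_gt0.
have [e1 [e10 P1] XY] := inf_adherent e20 (ky_fan_inf X Y).
have [e2 [e20' P2] YZ] := inf_adherent e20 (ky_fan_inf Y Z).
apply: (@le_trans _ _ (e1 + e2)); last first.
  by move: XY YZ; rewrite -!/(ky_fan _ _); lra.
apply: ge_inf; first exact: ky_fan_lb.
split; first exact: addr_gt0.
rewrite EFinD; apply: le_trans (leeD P1 P2).
apply: le_trans (measureU2 _ _ _); try exact: measurable_dist_ge.
apply: le_measure; rewrite ?inE; try exact: measurable_dist_ge.
  apply: measurableU; exact: measurable_dist_ge.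
move=> w; rewrite /dist_ge/= => XZ.
have := metric_triangle (X w : S) (Y w) (Z w).
case: (leP e1 (mdist (X w : S) (Y w))) => [|h t]; first by left.
by right; move: h t XZ; lra.
Qed.

HB.instance Definition _ := @isMetric.Build R L0 ky_fan ky_fanxx
  ky_fan_positivity ky_fan_sym ky_fan_triangle.

End L0.

(* Main.v *)
Require Import Defs.
From mathcomp Require Import all_boot all_order all_algebra.
From mathcomp Require Import all_classical all_reals all_analysis giry measurable_realfun.
From mathcomp Require Import ring lra zify.

(** A random point of [S] is encoded by bits, the [n]th of which tells whether
    it lies in the [n]th ball of a countable family whose small members cover
    [S] ([negligible_net]). The path of laws is lifted by moving the bits
    continuously with [t] and decoding them.

    For fixed [t], bits need not be the indicators of the balls. Let
    [psi t n : S -> [0, 1]] vanish outside the [n]th ball and be [1] on the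
    concentric ball of half the radius, and suppose that the events [b n] have
    the joint probabilities of bits which, given a point [x] drawn from
    [alpha t], are independent with parameters [psi t n x]. Two disjoint balls
    are then almost never selected together and small balls are almost surely
    selected, so that by completeness a unique point [Z] lies in all closed
    balls selected. Its law is [alpha t]: if [Z] is in a closed set [F], a small
    ball close to [F] is selected, which has at most the probability that
    [alpha t] gives to a neighbourhood of [F] ([decode_ex]).

    The joint probabilities are integrals of products of [psi t n] and
    [1 - psi t n], and must be continuous in [t]. At [t = 0] and [t = 1], where
    the random variables are prescribed, their bits are sharp indicators. Since
    the radii are chosen such that the spheres are negligible for [alpha 0] and
    [alpha 1], continuity survives if [psi t n] tends to the indicator of the
    ball at the end points and is continuous on [S] in between
    ([soft_indic_almost_continuous], [almost_continuous_expectation]).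

    It remains to find continuous paths of events with given joint probabilities
    and given end points. Bit after bit, every cell [A t] of the partition
    made by the preceding bits is to be split according to a continuous
    function [b t <= P (A t)]. Cut [A t] with the members of a maximal chain of
    events modulo null sets: as [P] is nonatomic, some member [G] has
    [P (A t `&` G) = b t] ([maximal_chain_ivt]), and as pieces of one set cut by
    one chain are comparable, [A t `&` G] depends continuously on [t]
    ([split_path]). The end points are met by exchanging gradually a splitting
    that is right at [0] for one that is right at [1]
    ([split_path_between]). *)

Set Implicit Arguments.
Unset Strict Implicit.
Unset Printing Implicit Defensive.
Import Order.TTheory GRing.Theory Num.Theory.
Import numFieldTopology.Exports numFieldNormedType.Exports.

Local Open Scope classical_set_scope.
Local Open Scope ring_scope.

(** * Real-valued probabilities *)

Section pr.
Context d (T : measurableType d) (R : realType) (mu : probability T R).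
Implicit Types A B C : set T.

Definition pr A : R := fine (mu A).

Lemma prE A : measurable A -> mu A = (pr A)%:E.
Proof. by move=> mA; rewrite /pr fineK// fin_num_measure. Qed.

Lemma pr_ge0 A : 0 <= pr A.
Proof. by rewrite /pr fine_ge0. Qed.

Lemma pr_set0 : pr set0 = 0.
Proof. by rewrite /pr measure0. Qed.

Lemma pr_setT : pr setT = 1.
Proof. by rewrite /pr probability_setT. Qed.

Lemma le_pr A B : measurable A -> measurable B -> A `<=` B -> pr A <= pr B.
Proof. by move=> mA mB AB; rewrite -lee_fin -!prE// le_measure ?inE. Qed.

Lemma prID A B : measurable A -> measurable B ->
  pr A = pr (A `&` B) + pr (A `\` B).
Proof.
move=> mA mB; apply: EFin_inj; rewrite EFinD -!prE//.
- by rewrite addeC; exact: measureDI.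
- exact: measurableD.
- exact: measurableI.
Qed.

Lemma prU A B : measurable A -> measurable B -> A `&` B = set0 ->
  pr (A `|` B) = pr A + pr B.
Proof.
move=> mA mB AB; apply: EFin_inj; rewrite EFinD -!prE//; last exact: measurableU.
exact: measureU.
Qed.

Lemma prU_le A B : measurable A -> measurable B -> pr (A `|` B) <= pr A + pr B.
Proof.
move=> mA mB; rewrite -lee_fin EFinD -!prE//; last exact: measurableU.
exact: measureU2.
Qed.

Lemma pr_setC A : measurable A -> pr (~` A) = 1 - pr A.
Proof.
move=> mA; rewrite -pr_setT (@prID setT A)// setTI setTD.
by rewrite addrAC subrr add0r.
Qed.

Lemma pr_bigcup0 (F : nat -> set T) : (forall n, measurable (F n)) ->
  (forall n, pr (F n) = 0) -> pr (\bigcup_n F n) = 0.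
Proof.
move=> mF F0; rewrite /pr (_ : mu _ = 0)//.
apply/negligibleP; first exact: bigcupT_measurable.
apply: negligible_bigcup => n; apply/negligibleP => //.
by apply: etrans (prE (mF n)) _; rewrite F0.
Qed.

Lemma pr0_le A B : measurable A -> measurable B -> A `<=` B -> pr B = 0 -> pr A = 0.
Proof.
by move=> mA mB AB B0; apply/eqP; rewrite eq_le pr_ge0 andbT -B0 le_pr.
Qed.

Lemma pr_bigcup_le (F : nat -> set T) (c : R) : (forall n, measurable (F n)) ->
  nondecreasing_seq F -> (forall n, pr (F n) <= c) -> pr (\bigcup_n F n) <= c.
Proof.
move=> mF ndF Fc; have mU : measurable (\bigcup_n F n) by exact: bigcupT_measurable.
have cv := @nondecreasing_cvg_mu _ _ _ mu F mF mU ndF.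
rewrite -lee_fin -prE// -(cvg_lim _ cv)//; apply: lime_le.
  by apply/cvg_ex; eexists; exact: cv.
by apply: nearW => n; rewrite /= prE// lee_fin.
Qed.

End pr.

(** Excluded middle is not included: the instances that an inclusion of sets
    needs are to be added to the goal. *)
Ltac sett := rewrite /setY/setD/setU/setI/setC/mkset/=; tauto.
Ltac settaut := let w := fresh "w" in move=> w; sett.

Ltac measset := repeat first [assumption | apply: measurableU
  | apply: measurableI | apply: measurableD | apply: measurableC
  | exact: measurableT | exact: measurable0
  | solve [multimatch goal with H : _ |- _ => apply H end] ].

(** * Splitting sets in a nonatomic space *)

Section chain.
Context d (T : measurableType d) (R : realType) (P : probability T R).
Hypothesis P_nonatomic : nonatomic P.
Local Notation pr := (pr P).
Implicit Types (A B E G : set T) (C : set (set T)).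

Definition ae_sub A B := pr (A `\` B) = 0.

Lemma ae_sub_trans A B E : measurable A -> measurable B -> measurable E ->
  ae_sub A B -> ae_sub B E -> ae_sub A E.
Proof.
move=> mA mB mE AB BE; apply/eqP; rewrite eq_le pr_ge0 andbT.
rewrite -(addr0 0) -{1}AB -BE; apply: le_trans (prU_le _ _ _); try by measset.
apply: le_pr; try by measset.
by move=> w; have := EM (B w); sett.
Qed.

Lemma subset_ae_sub A B : A `<=` B -> ae_sub A B.
Proof. by rewrite -setD_eq0 /ae_sub => ->; rewrite pr_set0. Qed.

Lemma ae_sub_le A B E : measurable A -> measurable B -> measurable E ->
  ae_sub A B -> pr (E `&` A) <= pr (E `&` B).
Proof.
move=> mA mB mE AB; rewrite -[leRHS]addr0 -AB.
apply: le_trans (prU_le _ _ _); try by measset.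
apply: le_pr; try by measset.
by move=> w; have := EM (B w); sett.
Qed.

Definition ae_comparable A B := ae_sub A B \/ ae_sub B A.

(** Maximality is modulo null sets too: [C] contains every measurable set that is
    almost everywhere comparable with its members. *)
Definition maximal_chain C := [/\ C `<=` measurable,
  (forall A B, C A -> C B -> ae_comparable A B) &
  (forall E, measurable E -> (forall A, C A -> ae_comparable E A) -> C E)].

Lemma maximal_chain_ex : exists C, maximal_chain C.
Proof.
pose Q C := C `<=` measurable /\ forall A B, C A -> C B -> ae_comparable A B.
have [F FQ Ftot|C [[mC totC] maxC]] := @Zorn_bigcup (set T) Q.
  split; first by move=> A [C FC CA]; have [mC _] := FQ _ FC; exact: mC.
  move=> A B [C FC CA] [D FD DB]; have [CD|DC] := Ftot _ _ FC FD.
    by have [_] := FQ _ FD; apply => //; exact: CD.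
  by have [_] := FQ _ FC; apply => //; exact: DC.
exists C; split => // E mE compE; apply: contrapT => CE.
apply: (maxC (C `|` [set E])).
  split; first by move=> A; left.
  by move=> sub; apply: CE; apply: sub; right.
split; first by move=> A [/mC//|->].
move=> A B [CA|->] [CB|->].
- exact: totC.
- by have [|] := compE _ CA; [right|left].
- exact: compE.
- by left; exact: subset_ae_sub.
Qed.

Lemma maximal_chain_setC C : maximal_chain C ->
  maximal_chain [set A | C (~` A)].
Proof.
have subC A B : ae_sub (~` A) (~` B) = ae_sub B A.
  by rewrite /ae_sub; congr (pr _ = 0); rewrite setDE setCK setIC -setDE.
have compC A B : ae_comparable (~` A) (~` B) -> ae_comparable A B.
  by rewrite /ae_comparable !subC; tauto.
move=> [mC totC maxC]; split => /=.
- by move=> A /mC; rewrite -{2}(setCK A); exact: measurableC.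
- by move=> A B CA CB; apply: compC; exact: totC.
- move=> E mE compE; apply: maxC; first exact: measurableC.
  by move=> A CA; apply: compC; rewrite setCK; apply: compE; rewrite /= setCK.
Qed.

(** The union of all members [G] with [pr (A `&` G) <= b] need not be measurable;
    but that of countably many of them, whose probabilities approach the supremum,
    contains each of them up to a null set. *)
Lemma maximal_chain_lower C A (b : R) : maximal_chain C -> measurable A ->
  0 <= b -> exists L, [/\ C L, pr (A `&` L) <= b &
    forall G, C G -> pr (A `&` G) <= b -> ae_sub G L].
Proof.
move=> [mC totC maxC] mA b0.
pose D := [set G | C G /\ pr (A `&` G) <= b].
have D0 : D set0.
  split; last by rewrite setI0 pr_set0.
  by apply: maxC => // B CB; left; exact: subset_ae_sub.
pose V := [set pr G | G in D].
have supV : has_sup V.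
  split; first by exists (pr set0); exists set0.
  exists 1 => _ [G [CG _] <-]; rewrite -(pr_setT P); apply: le_pr => //.
  exact: mC.
have /choice[G DG] (n : nat) : exists G, D G /\ sup V - n.+1%:R^-1 < pr G.
  have n0 : 0 < (n.+1%:R^-1 : R) by rewrite invr_gt0.
  by have [_ [G DG <-]] := sup_adherent n0 supV; exists G.
have mG n : measurable (G n) by have [[/mC]] := DG n.
pose L := \bigcup_n G n.
have mL : measurable L by exact: bigcupT_measurable.
have DL E : D E -> ae_sub E L.
  move=> [CE Eb]; have mE := mC _ CE.
  have GL n : G n `<=` L by move=> w; exists n.
  have [[n EG]|nEG] := pselect (exists n, ae_sub E (G n)).
    by apply: ae_sub_trans EG _ => //; apply: subset_ae_sub.
  have GE n : ae_sub (G n) E.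
    have [[CGn _] _] := DG n; have [//|EG] := totC _ _ CGn CE.
    by exfalso; apply: nEG; exists n.
  apply/eqP; rewrite eq_le pr_ge0 andbT; apply/ler_addgt0Pl => e e0.
  rewrite addr0; have [n _ /(_ n (leqnn _))/= ne] := near_infty_natSinv_lt (PosNum e0).
  have supE : pr E <= sup V by apply: ub_le_sup; [case: supV|exists E].
  have [_ Gn] := DG n; have := GE n; rewrite /ae_sub => GE0.
  have h1 := prID P mE (mG n); have h2 := prID P (mG n) mE.
  have h3 : pr (E `\` L) <= pr (E `\` G n).
    by apply: le_pr; [measset|measset|move=> w [Ew nLw]; split => // /GL].
  rewrite setIC in h2; move: Gn; have : n.+1%:R^-1 < e := ne.
  by move: (n.+1%:R^-1) h1 h2 h3 GE0 supE => r; lra.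
exists L; split; last by move=> E CE Eb; exact: DL.
- apply: maxC => // E CE; have mE := mC _ CE.
  have [Eb|Eb] := leP (pr (A `&` E)) b; first by right; exact: DL.
  left; rewrite /ae_sub setD_bigcupl; apply: pr_bigcup0.
    by move=> n; measset.
  move=> n; have [[CGn Gb] _] := DG n; have [//|EG] := totC _ _ CGn CE.
  exfalso; move: Eb; apply/negP; rewrite -leNgt; apply: le_trans Gb.
  exact: ae_sub_le.
- pose H n := \big[setU/set0]_(k < n.+1) G k.
  have HG n : exists k, ae_sub (H n) (G k).
    elim: n => [|n [k HGk]].
      by exists 0%N; rewrite /H big_ord1; exact: subset_ae_sub.
    have mH : measurable (H n) by apply: bigsetU_measurable.
    have HSn : H n.+1 = H n `|` G n.+1 by rewrite /H big_ord_recr.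
    have [[CGk _] _] := DG k; have [[CGn _] _] := DG n.+1.
    have join X Y Z : measurable X -> measurable Y -> measurable Z ->
        ae_sub X Z -> ae_sub Y Z -> ae_sub (X `|` Y) Z.
      move=> mX mY mZ XZ YZ; apply/eqP; rewrite eq_le pr_ge0 andbT.
      rewrite -(addr0 0) -{1}XZ -YZ setDUl; apply: prU_le; measset.
    have [kn|nk] := totC _ _ CGk CGn.
      exists n.+1; rewrite HSn; apply: join => //.
        exact: ae_sub_trans HGk kn.
      exact: subset_ae_sub.
    by exists k; rewrite HSn; exact: join.
  have LH : A `&` L = \bigcup_n (A `&` H n).
    rewrite -setI_bigcupr; congr (_ `&` _); apply/seteqP; split => w.
      by move=> [n _ Gw]; exists n => //; rewrite /H big_ord_recr; right.
    move=> [n _]; rewrite /H -bigcup_mkord => -[k _ Gw]; by exists k.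
  have mH n : measurable (H n) by apply: bigsetU_measurable.
  rewrite LH; apply: pr_bigcup_le.
  + by move=> n; measset.
  + apply/nondecreasing_seqP => n; apply/subsetPset; apply: setIS.
    by rewrite [X in _ `<=` X]/H big_ord_recr; left.
  + move=> n; have [k HGk] := HG n; have [[_ Gb] _] := DG k.
    by apply: le_trans Gb; exact: ae_sub_le.
Qed.

(** A nonatomic measure cannot jump over [b] along a maximal chain: an
    intermediate subset of the gap would extend the chain. *)
Lemma maximal_chain_ivt C A (b : R) : maximal_chain C -> measurable A ->
  0 <= b <= pr A -> exists2 G, C G & pr (A `&` G) = b.
Proof.
move=> maxC mA /andP[b0 bA].
have [L [CL Lb LP]] := maximal_chain_lower maxC mA b0.
(* the other side of the gap, found in the chain of complements *)
have b0' : 0 <= pr A - b by rewrite subr_ge0.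
have [U' [/= CU Ub UP]] :=
  maximal_chain_lower (maximal_chain_setC maxC) mA b0'.
have {CU Ub UP} [U [CU Ub UP]] : exists U, [/\ C U, b <= pr (A `&` U) &
    forall G, C G -> b <= pr (A `&` G) -> ae_sub U G].
  have [mC _ _] := maxC.
  have mU := mC _ CU; have mU' : measurable U' by rewrite -(setCK U'); measset.
  have split_A G := @prID _ _ _ P A G mA.
  exists (~` U'); split => //.
    by have := split_A _ mU'; rewrite setDE; move: Ub; lra.
  move=> G CG bG; have mG := mC _ CG; rewrite /ae_sub setDE setIC -setDE.
  apply: UP; first by rewrite /= setCK.
  by have := split_A _ mG; rewrite setDE; lra.
have [mC totC mx] := maxC; have mL := mC _ CL; have mU := mC _ CU.
have [Lb'|Lb'] := eqVneq (pr (A `&` L)) b; first by exists L.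
have [Ub'|Ub'] := eqVneq (pr (A `&` U)) b; first by exists U.
exfalso.
have mAUL : measurable (A `&` (U `\` L)) by measset.
have gap : 0 < pr (A `&` (U `\` L)).
  have : pr (A `&` U) <= pr (A `&` L) + pr (A `&` (U `\` L)).
    apply: le_trans (prU_le _ _ _); try by measset.
    by apply: le_pr; [measset|measset|move=> w; have := EM (L w); sett].
  have : pr (A `&` L) < b by rewrite lt_neqAle Lb' Lb.
  have : b < pr (A `&` U) by rewrite lt_neqAle eq_sym Ub' Ub.
  lra.
have [B [mB BAUL /andP[B0 BU]]] : exists B, [/\ measurable B,
    B `<=` A `&` (U `\` L) & 0 < pr B < pr (A `&` (U `\` L))].
  have [|B [mB BA]] := P_nonatomic mAUL; first by rewrite prE// lte_fin.
  by rewrite !prE// !lte_fin => BP; exists B.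
pose E := L `|` B.
have mE : measurable E by measset.
have CE : C E.
  apply: mx => // G CG; have mG := mC _ CG.
  have [Gb|Gb] := leP (pr (A `&` G)) b.
    right; have := LP _ CG Gb; apply: pr0_le; try by measset.
    by rewrite /E; settaut.
  left; have UG := UP _ CG (ltW Gb).
  have LG : ae_sub L G.
    have [//|GL] := totC _ _ CL CG; exfalso; move: Gb; apply/negP.
    rewrite -leNgt; apply: le_trans Lb; exact: ae_sub_le.
  apply/eqP; rewrite eq_le pr_ge0 andbT -(addr0 0) -{1}LG -UG.
  apply: le_trans (prU_le _ _ _); try by measset.
  apply: le_pr; try by measset.
  by rewrite /E => w; have := BAUL w; sett.
have [Eb|Eb] := leP (pr (A `&` E)) b.
  have := LP _ CE Eb; rewrite /ae_sub (_ : E `\` L = B); first by lra.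
  by apply/seteqP; split => w; have := BAUL w; rewrite /E; sett.
have := UP _ CE (ltW Eb); rewrite /ae_sub => UE.
have : pr (A `&` (U `\` L) `\` B) = 0.
  apply: pr0_le UE; try by measset.
  by rewrite /E; settaut.
have := prID P mAUL mB; rewrite (setIidr BAUL); lra.
Qed.

End chain.

(** * Continuous paths of events *)

Section set_path.
Context d (Omega : measurableType d) (R : realType) (P : probability Omega R).
Context (T : topologicalType).
Local Notation pr := (pr P).
Implicit Types (A B : T -> set Omega) (b : T -> R).

(** Continuity for the pseudometric [P (A `+` B)] on events. *)
Definition set_path A := (forall t, measurable (A t)) /\
  forall t e, 0 < e -> \forall s \near t, pr (A s `+` A t) < e.

Lemma pr_setY_dist (X Y : set Omega) : measurable X -> measurable Y ->
  `|pr X - pr Y| <= pr (X `+` Y).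
Proof.
move=> mX mY; have aux U V : measurable U -> measurable V ->
    pr U <= pr V + pr (U `+` V).
  move=> mU mV; apply: le_trans (prU_le _ _ _); rewrite /setY; try by measset.
  by apply: le_pr; [measset|measset|move=> w; have := EM (V w); sett].
have := aux X Y mX mY; have := aux Y X mY mX.
by rewrite ler_norml /setY (setUC (Y `\` X)); lra.
Qed.

Lemma set_path_continuous A : set_path A -> continuous (fun t => pr (A t)).
Proof.
move=> [mA cA] t; apply/cvgrPdist_lt => e e0; near=> s.
rewrite distrC; apply: le_lt_trans (pr_setY_dist _ _) _ => //.
by near: s; exact: cA.
Unshelve. all: by end_near. Qed.

Lemma set_path_cst (X : set Omega) : measurable X -> set_path (fun=> X).
Proof. by move=> mX; split => // t e e0; near=> s; rewrite setYK pr_set0.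
Unshelve. all: by end_near. Qed.

Let set_path_op (op : set Omega -> set Omega -> set Omega) A B :
  (forall X Y, measurable X -> measurable Y -> measurable (op X Y)) ->
  (forall X X' Y Y', op X Y `+` op X' Y' `<=` (X `+` X') `|` (Y `+` Y')) ->
  set_path A -> set_path B -> set_path (fun t => op (A t) (B t)).
Proof.
move=> mop sop [mA cA] [mB cB]; split => [t|t e e0]; first exact: mop.
have e20 : 0 < e / 2 by rewrite divr_gt0.
near=> s.
have As : pr (A s `+` A t) < e / 2 by near: s; exact: cA.
have Bs : pr (B s `+` B t) < e / 2 by near: s; exact: cB.
apply: (@le_lt_trans _ _ (pr (A s `+` A t) + pr (B s `+` B t))); last by lra.
have mopl := mop _ _ (mA s) (mB s); have mopr := mop _ _ (mA t) (mB t).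
have [mAs mAt mBs mBt] := And4 (mA s) (mA t) (mB s) (mB t).
apply: le_trans (prU_le _ _ _); rewrite /setY; try by measset.
by apply: le_pr; [measset|measset|exact: sop].
Unshelve. all: by end_near. Qed.

Lemma set_pathU A B : set_path A -> set_path B ->
  set_path (fun t => A t `|` B t).
Proof.
apply: set_path_op => [|X X' Y Y']; [exact: measurableU|move=> w].
by have := EM (X w); have := EM (X' w); have := EM (Y w); have := EM (Y' w); sett.
Qed.

Lemma set_pathI A B : set_path A -> set_path B ->
  set_path (fun t => A t `&` B t).
Proof.
apply: set_path_op => [|X X' Y Y']; [exact: measurableI|move=> w].
by have := EM (X w); have := EM (X' w); have := EM (Y w); have := EM (Y' w); sett.
Qed.

Lemma set_pathD A B : set_path A -> set_path B ->
  set_path (fun t => A t `\` B t).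
Proof.
apply: set_path_op => [|X X' Y Y']; [exact: measurableD|move=> w].
by have := EM (X w); have := EM (X' w); have := EM (Y w); have := EM (Y' w); sett.
Qed.

Hypothesis P_nonatomic : nonatomic P.

(** Cutting every [A t] with members of one maximal chain makes the pieces
    comparable, so that two of them are close as soon as their measures are. *)
Lemma split_path A b : set_path A -> continuous b ->
  (forall t, 0 <= b t <= pr (A t)) ->
  exists B, set_path B /\ forall t, B t `<=` A t /\ pr (B t) = b t.
Proof.
move=> [mA cA] cb bA; have [C maxC] := maximal_chain_ex P.
have [mC totC _] := maxC.
have /choice[G GP] t : exists G, C G /\ pr (A t `&` G) = b t.
  by have [G] := maximal_chain_ivt P_nonatomic maxC (mA t) (bA t); exists G.
have mG t : measurable (G t) by have [/mC] := GP t.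
exists (fun t => A t `&` G t); split; last first.
  by move=> t; split; [exact: subIsetl|have [] := GP t].
split => [t|t e e0]; first by measset.
have e30 : 0 < e / 3 by rewrite divr_gt0.
have cbt : \forall s \near t, `|b t - b s| < e / 3.
  by have /cvgrPdist_lt := cb t; apply.
near=> s.
have As : pr (A s `+` A t) < e / 3 by near: s; exact: cA.
have bs : `|b t - b s| < e / 3 by near: s.
have [mAs mAt mGs mGt] := And4 (mA s) (mA t) (mG s) (mG t).
have {}totC : pr (A t `&` (G s `+` G t)) <= `|pr (A t `&` G s) - b t|.
  have [[CGs _] [CGt <-]] := (GP s, GP t).
  have aux U V : measurable U -> measurable V -> ae_sub P U V ->
      pr (A t `&` (U `+` V)) <= `|pr (A t `&` U) - pr (A t `&` V)|.
    move=> mU mV UV; have mAU : measurable (A t `&` U) by measset.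
    have mAV : measurable (A t `&` V) by measset.
    have h1 : pr (A t `&` (U `+` V)) <= pr (U `\` V) + pr ((A t `&` V) `\` U).
      apply: le_trans (prU_le _ _ _); rewrite /setY; try by measset.
      by apply: le_pr; [measset|measset|settaut].
    have h2 := prID P mAV mU; have h3 := prID P mAU mV.
    have h4 : A t `&` V `&` U = A t `&` U `&` V by rewrite setIAC.
    have h5 : pr ((A t `&` U) `\` V) = 0.
      by apply: pr0_le UV; [measset|measset|settaut].
    rewrite ler_normr; apply/orP; right.
    by move: h1; rewrite UV h2 h3 h4; lra.
  have [|] := totC _ _ CGs CGt; first exact: aux.
  by rewrite distrC /setY (setUC (G s `\` _)); exact: aux.
have d1 : `|pr (A t `&` G s) - b s| <= pr (A s `+` A t).
  have [_ <-] := GP s; apply: le_trans (pr_setY_dist _ _) _; try by measset.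
  by apply: le_pr; rewrite /setY; [measset|measset|settaut].
have d2 : `|pr (A t `&` G s) - b t| <= `|pr (A t `&` G s) - b s| + `|b t - b s|.
  by rewrite (distrC (b t)); apply: le_trans (ler_normD _ _); rewrite addrA subrK.
apply: (@le_lt_trans _ _ (pr (A s `+` A t) + pr (A t `&` (G s `+` G t)))).
  apply: le_trans (prU_le _ _ _); rewrite /setY; try by measset.
  apply: le_pr; [measset|measset|move=> w].
  by have := EM (G s w); have := EM (G t w); have := EM (A t w); sett.
move: As bs totC d1 d2; lra.
Unshelve. all: by end_near. Qed.

(** The mass is taken from [B0] as long as possible, and from its complement for
    the rest; at [t0] this takes [B0] exactly. *)
Lemma split_path_from A b t0 (B0 : set Omega) : set_path A -> continuous b ->
  (forall t, 0 <= b t <= pr (A t)) -> measurable B0 ->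
  pr (B0 `\` A t0) = 0 -> pr B0 = b t0 ->
  exists B, [/\ set_path B, (forall t, B t `<=` A t),
    (forall t, pr (B t) = b t) & pr (B t0 `+` B0) = 0].
Proof.
move=> pA cb bA mB0 B0A B0b; have [mA _] := pA.
have pAI := set_pathI pA (set_path_cst mB0).
have pAD := set_pathD pA (set_path_cst mB0).
pose b1 t := Num.min (b t) (pr (A t `&` B0)).
have cb1 : continuous b1.
  by move=> t; exact: (continuous_min (cb t) (@set_path_continuous _ pAI t)).
have b1b t : 0 <= b1 t <= pr (A t `&` B0).
  by rewrite le_min ge_min lexx orbT pr_ge0 !andbT; case/andP: (bA t).
have [B1 [pB1 B1P]] := split_path pAI cb1 b1b.
have cb2 : continuous (fun t => b t - b1 t).
  by move=> t; apply: cvgB; [exact: cb|exact: cb1].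
have b2b t : 0 <= b t - b1 t <= pr (A t `\` B0).
  have h := prID P (mA t) mB0; have /andP[_ bAt] := bA t.
  rewrite subr_ge0 ge_min lexx/= lerBlDr -lerBlDl le_min.
  have := pr_ge0 P (A t `\` B0); move: h bAt => -> *.
  by apply/andP; split; lra.
have [B2 [pB2 B2P]] := split_path pAD cb2 b2b.
have prB t : pr (B1 t `|` B2 t) = b t.
  rewrite prU; [|by case: pB1|by case: pB2|].
    have [_ ->] := B1P t; have [_ ->] := B2P t; by lra.
  apply/seteqP; split => // w [/(proj1 (B1P t)) h1 /(proj1 (B2P t)) h2].
  by move: h1 h2; rewrite /setI /setD /mkset; tauto.
exists (fun t => B1 t `|` B2 t); split => //.
- exact: set_pathU.
- move=> t w [/(proj1 (B1P t))|/(proj1 (B2P t))] [] //.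
- have [[mB1 _] [mB2 _]] := (pB1, pB2).
  have h0 := prID P mB0 (mA t0); rewrite B0A addr0 setIC in h0.
  have b10 : b1 t0 = b t0 by rewrite /b1 -B0b h0 minxx.
  have [sB2 B20] := B2P t0; rewrite b10 subrr in B20.
  have [sB1 B10] := B1P t0; rewrite b10 -B0b h0 in B10.
  have mI : measurable (A t0 `&` B0) by have := mA t0; move=> ?; measset.
  have h1 := prID P mI (mB1 t0).
  rewrite (setIidr sB1) -B10 in h1.
  have mAt0 := mA t0; have mB1t := mB1 t0; have mB2t := mB2 t0.
  have h2 : pr ((A t0 `&` B0) `\` B1 t0) = 0 by lra.
  apply/eqP; rewrite eq_le pr_ge0 andbT -(addr0 0) -{1}h2 -[X in _ <= _ + X](addr0 0).
  rewrite -{1}B20 -B0A addrA.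
  apply: (@le_trans _ _ (pr (((A t0 `&` B0) `\` B1 t0) `|` B2 t0) + pr (B0 `\` A t0))).
    apply: le_trans (prU_le _ _ _); rewrite /setY; try by measset.
    apply: le_pr; [measset|measset|move=> w].
    by have := sB1 w; have := EM (A t0 w); have := EM (B2 t0 w); sett.
  by rewrite lerD2r; apply: prU_le; measset.
Qed.

(** Between the solutions [D0] and [D1] prescribed at one point each, a fraction
    [tau] of [D0 \ D1] is exchanged for the same mass of [D1 \ D0]. *)
Lemma split_path_between A b t0 t1 (tau : T -> R) (B0 B1 : set Omega) :
  set_path A -> continuous b -> (forall t, 0 <= b t <= pr (A t)) ->
  continuous tau -> (forall t, 0 <= tau t <= 1) -> tau t0 = 0 -> tau t1 = 1 ->
  measurable B0 -> pr (B0 `\` A t0) = 0 -> pr B0 = b t0 ->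
  measurable B1 -> pr (B1 `\` A t1) = 0 -> pr B1 = b t1 ->
  exists B, [/\ set_path B, (forall t, B t `<=` A t),
    (forall t, pr (B t) = b t), pr (B t0 `+` B0) = 0 & pr (B t1 `+` B1) = 0].
Proof.
move=> pA cb bA ctau tau01 tau0 tau1 mB0 B0A B0b mB1 B1A B1b.
have [D0 [pD0 D0A D0b D0B]] := split_path_from pA cb bA mB0 B0A B0b.
have [D1 [pD1 D1A D1b D1B]] := split_path_from pA cb bA mB1 B1A B1b.
have [[mD0 _] [mD1 _]] := (pD0, pD1).
have pI := set_pathI pD0 pD1.
have pD01 := set_pathD pD0 pD1; have pD10 := set_pathD pD1 pD0.
pose m t := pr (D0 t `\` D1 t).
have mE t : pr (D1 t `\` D0 t) = m t.
  have := prID P (mD0 t) (mD1 t); have := prID P (mD1 t) (mD0 t).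
  by rewrite D0b D1b (setIC (D1 t)) /m; lra.
have cm : continuous m := set_path_continuous pD01.
have m0 t : 0 <= m t := pr_ge0 P _.
have cb1 : continuous (fun t => (1 - tau t) * m t).
  move=> t; apply: cvgM; last exact: cm.
  by apply: cvgB; [exact: cvg_cst|exact: ctau].
have cb2 : continuous (fun t => tau t * m t).
  by move=> t; apply: cvgM; [exact: ctau|exact: cm].
have b1b t : 0 <= (1 - tau t) * m t <= pr (D0 t `\` D1 t).
  have /andP[t0' t1'] := tau01 t; rewrite mulr_ge0//= ?subr_ge0//.
  by rewrite ler_piMl// lerBlDr lerDl.
have b2b t : 0 <= tau t * m t <= pr (D1 t `\` D0 t).
  have /andP[t0' t1'] := tau01 t; rewrite mulr_ge0//= ?subr_ge0// mE.
  by rewrite ler_piMl.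
have [E0 [pE0 E0P]] := split_path pD01 cb1 b1b.
have [E1 [pE1 E1P]] := split_path pD10 cb2 b2b.
have [[mE0 _] [mE1 _]] := (pE0, pE1).
pose B t := (D0 t `&` D1 t) `|` (E0 t `|` E1 t).
have endpoint X Y D D' E E' : measurable X -> measurable D -> measurable D' ->
    measurable E -> measurable E' -> Y = (D `&` D') `|` (E `|` E') ->
    E `<=` D `\` D' -> E' `<=` D' `\` D -> pr E = pr (D `\` D') -> pr E' = 0 ->
    pr (D `+` X) = 0 -> pr (Y `+` X) = 0.
  move=> mX mD mD' mEE mE' -> sE sE' EE E'0 DX.
  have mDD : measurable (D `\` D') by measset.
  have := prID P mDD mEE; rewrite (setIidr sE) EE => h.
  have {}h : pr ((D `\` D') `\` E) = 0 by lra.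
  apply/eqP; rewrite eq_le pr_ge0 andbT.
  rewrite -(addr0 0) -{1}DX -[X in _ <= _ + X](addr0 0) -{1}E'0 -h.
  apply: (@le_trans _ _ (pr (D `+` X) + pr (E' `|` ((D `\` D') `\` E)))).
    apply: le_trans (prU_le _ _ _); rewrite /setY; try by measset.
    apply: le_pr; [measset|measset|move=> w].
    have := sE w; have := sE' w; have := EM (D w); have := EM (D' w).
    by have := EM (E' w); have := EM (E w); have := EM (X w); sett.
  by rewrite lerD2l; apply: prU_le; measset.
exists B; split.
- by apply: set_pathU; [|exact: set_pathU].
- move=> t w [[/D0A//]|[/(proj1 (E0P t))[/D0A]//|/(proj1 (E1P t))[/D1A]//]].
- move=> t; have [sE0 E0b] := E0P t; have [sE1 E1b] := E1P t.
  have [mD0t mD1t mE0t mE1t] := And4 (mD0 t) (mD1 t) (mE0 t) (mE1 t).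
  rewrite /B prU; [|by measset|by measset|].
    rewrite prU //; first last.
      by apply/seteqP; split => // w; have := sE0 w; have := sE1 w; sett.
    have := prID P mD0t mD1t; rewrite D0b E0b E1b -/(m t) => ->.
    by rewrite mulrBl mul1r subrK.
  by apply/seteqP; split => // w; have := sE0 w; have := sE1 w; sett.
- have [sE0 E0b] := E0P t0; have [sE1 E1b] := E1P t0.
  rewrite tau0 subr0 mul1r in E0b; rewrite tau0 mul0r in E1b.
  exact: (endpoint B0 (B t0) (D0 t0) (D1 t0) (E0 t0) (E1 t0)).
- have [sE0 E0b] := E0P t1; have [sE1 E1b] := E1P t1.
  rewrite tau1 subrr mul0r in E0b; rewrite tau1 mul1r -mE in E1b.
  apply: (endpoint B1 (B t1) (D1 t1) (D0 t1) (E1 t1) (E0 t1)) => //.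
  by rewrite /B setIC (setUC (E0 t1)).
Qed.

End set_path.

(** * Sequences of events with prescribed joint probabilities *)

(** Bits are listed with the last one first, so that a cell is refined by adding
    a bit at the head of the list. *)
Fixpoint cell (X : Type) (E : nat -> set X) (s : seq bool) : set X :=
  if s is b :: s' then
    cell E s' `&` (if b then E (size s') else ~` E (size s'))
  else setT.

Lemma cell_ex (X : Type) (E : nat -> set X) n x :
  exists2 s, size s = n & cell E s x.
Proof.
elim: n => [|n [s sn sx]]; first by exists [::].
have [Ex|Ex] := pselect (E n x).
  by exists (true :: s); rewrite /= ?sn.
by exists (false :: s); rewrite /= ?sn.
Qed.

Lemma cell_measurable d (X : measurableType d) (E : nat -> set X) s :
  (forall n, measurable (E n)) -> measurable (cell E s).
Proof.
move=> mE; elim: s => [|[] s IH] /=; [exact: measurableT|..].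
  exact: measurableI.
by apply: measurableI => //; exact: measurableC.
Qed.

Section bits.
Context d (Omega : measurableType d) (R : realType) (P : probability Omega R).
Context (T : topologicalType).
Hypothesis P_nonatomic : nonatomic P.
Local Notation pr := (pr P).
Local Notation set_path := (@set_path _ Omega R P T).

Lemma set_path_bigsetU (I : Type) (r : seq I) (F : I -> T -> set Omega) :
  (forall i, set_path (F i)) ->
  set_path (fun t => \big[setU/set0]_(i <- r) F i t).
Proof.
move=> pF; elim: r => [|i r IH].
  rewrite (_ : (fun t => _) = fun=> set0); first exact: set_path_cst.
  by apply/funext => t; rewrite big_nil.
rewrite (_ : (fun t => _) =
  fun t => F i t `|` \big[setU/set0]_(j <- r) F j t); first exact: set_pathU.
by apply/funext => t; rewrite big_cons.
Qed.

Lemma pr_bigsetU0 (I : Type) (r : seq I) (F : I -> set Omega) :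
  (forall i, measurable (F i)) -> (forall i, pr (F i) = 0) ->
  pr (\big[setU/set0]_(i <- r) F i) = 0.
Proof.
move=> mF F0; elim: r => [|i r IH]; first by rewrite big_nil pr_set0.
rewrite big_cons; apply/eqP; rewrite eq_le pr_ge0 andbT -(addr0 0).
rewrite -{1}(F0 i) -IH; apply: prU_le => //.
exact: bigsetU_measurable.
Qed.

Variables (w : seq bool -> T -> R) (t0 t1 : T) (tau : T -> R).
Variables (E0 E1 : nat -> set Omega).
Hypotheses (w_continuous : forall s, continuous (w s))
  (w_nil : forall t, w [::] t = 1) (w_ge0 : forall s t, 0 <= w s t)
  (w_cons : forall s t, w (true :: s) t + w (false :: s) t = w s t).
Hypotheses (tau_continuous : continuous tau)
  (tau01 : forall t, 0 <= tau t <= 1) (tau0 : tau t0 = 0) (tau1 : tau t1 = 1).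
Hypotheses (mE0 : forall n, measurable (E0 n))
  (mE1 : forall n, measurable (E1 n))
  (E0w : forall s, pr (cell E0 s) = w s t0)
  (E1w : forall s, pr (cell E1 s) = w s t1).

Let node_spec s A := [/\ set_path A, (forall t, pr (A t) = w s t),
  pr (A t0 `+` cell E0 s) = 0 & pr (A t1 `+` cell E1 s) = 0].

Let child_ex s A : node_spec s A ->
  exists B, node_spec (true :: s) B /\ forall t, B t `<=` A t.
Proof.
move=> [pA Aw A0 A1]; have [mA _] := pA.
have wA t : 0 <= w (true :: s) t <= pr (A t).
  by rewrite w_ge0 Aw -(w_cons s) lerDl w_ge0.
have mC0 := cell_measurable (true :: s) mE0.
have mC1 := cell_measurable (true :: s) mE1.
have mc0 := cell_measurable s mE0; have mc1 := cell_measurable s mE1.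
have C0A : pr (cell E0 (true :: s) `\` A t0) = 0.
  by apply: pr0_le A0; rewrite /setY; [measset|measset|rewrite /=; settaut].
have C1A : pr (cell E1 (true :: s) `\` A t1) = 0.
  by apply: pr0_le A1; rewrite /setY; [measset|measset|rewrite /=; settaut].
have [B [pB BA Bw B0 B1]] := split_path_between P_nonatomic pA
  (w_continuous (s := true :: s)) wA tau_continuous tau01 tau0 tau1
  mC0 C0A (E0w _) mC1 C1A (E1w _).
by exists B.
Qed.

Let sibling s A B : node_spec s A -> node_spec (true :: s) B ->
  (forall t, B t `<=` A t) -> node_spec (false :: s) (fun t => A t `\` B t).
Proof.
move=> [pA Aw A0 A1] [pB Bw B0 B1] BA; have [[mA _] [mB _]] := (pA, pB).
have endpoint t E : (forall n, measurable (E n)) -> pr (A t `+` cell E s) = 0 ->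
    pr (B t `+` cell E (true :: s)) = 0 ->
    pr ((A t `\` B t) `+` cell E (false :: s)) = 0.
  move=> mE AE BE.
  have mc b := cell_measurable (b :: s) mE; have mcs := cell_measurable s mE.
  apply/eqP; rewrite eq_le pr_ge0 andbT -(addr0 0) -{1}AE -BE.
  apply: le_trans (prU_le _ _ _); rewrite /setY; try by measset.
  apply: le_pr; [measset|measset|move=> x /=].
  have := EM (A t x); have := EM (B t x); have := EM (cell E s x).
  by have := EM (E (size s) x); have := BA t x; sett.
split; [exact: set_pathD| |exact: endpoint|exact: endpoint].
move=> t; have := prID P (mA t) (mB t).
by rewrite (setIidr (@BA t)) Aw Bw -(w_cons s); lra.
Qed.

(** The tree of cells is built from the root by splitting the cell [A s] into
    [A (true :: s)] and its complement in [A s], so that the events on which the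
    bits are [true] are finite unions of cells. *)
Lemma bits_ex : exists B : nat -> T -> set Omega,
  [/\ forall n, set_path (B n),
      forall s t, pr (cell (B^~ t) s) = w s t,
      forall n, pr (B n t0 `+` E0 n) = 0 &
      forall n, pr (B n t1 `+` E1 n) = 0].
Proof.
have /choice[next nextP] (sA : seq bool * (T -> set Omega)) : exists B,
    node_spec sA.1 sA.2 ->
    node_spec (true :: sA.1) B /\ forall t, B t `<=` sA.2 t.
  have [/child_ex[B BP]|nA] := pselect (node_spec sA.1 sA.2); first by exists B.
  by exists sA.2.
pose node := fix node s : T -> set Omega := match s with
  | [::] => fun=> setT
  | true :: s' => next (s', node s')
  | false :: s' => fun t => node s' t `\` next (s', node s') t
  end.
have nodeP s : node_spec s (node s).
  elim: s => [|b s IH].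
    split; [exact: set_path_cst|by move=> t; rewrite pr_setT w_nil|..];
    by rewrite /= setYK pr_set0.
  have [BP BA] := nextP (s, node s) IH.
  by case: b => //=; exact: sibling.
have nodeS b s t : node (b :: s) t `<=` node s t.
  case: b => /=; last exact: subDsetl.
  by have [_] := nextP (s, node s) (nodeP s); exact.
have node_inj s s' t x : size s = size s' -> node s t x -> node s' t x -> s = s'.
  elim: s s' => [|b s IH] [|b' s']// [ss'] sx sx'.
  have := IH _ ss' (nodeS _ _ _ _ sx) (nodeS _ _ _ _ sx') => es.
  rewrite -{}es in sx' *; congr (_ :: _).
  by case: b b' sx sx' => -[]//= => [h [_]|[_ ?]].
pose B n t := \big[setU/set0]_(s : n.-tuple bool) node (true :: s) t.
have BP n t x : B n t x <-> exists2 s, size s = n & node (true :: s) t x.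
  rewrite /B -bigcup_seq; split => [[s _ sx]|[s /eqP sn sx]].
    by exists s => //; exact: size_tuple.
  by exists (Tuple sn) => //; exact: mem_index_enum.
have nodeE s t : node s t = cell (B^~ t) s.
  elim: s => [//|b s IH].
  have tE : node (true :: s) t = node s t `&` B (size s) t.
    apply/seteqP; split => x.
      by move=> sx; split; [exact: nodeS sx|apply/BP; exists s].
    move=> [sx /BP[s' ss' sx']].
    by rewrite (node_inj _ _ _ _ (esym ss') sx (nodeS _ _ _ _ sx')).
  case: b => /=; rewrite -IH //.
  have -> : next (s, node s) t = node (true :: s) t by [].
  rewrite tE; apply/seteqP; split => x; have := EM (B (size s) t x); sett.
have endpoint t E : (forall n, measurable (E n)) ->
    (forall s, pr (node s t `+` cell E s) = 0) ->
    forall n, pr (B n t `+` E n) = 0.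
  move=> mE nE n.
  have mc s := cell_measurable s mE.
  have mn s : measurable (node s t) by have [[]] := nodeP s.
  have mB : measurable (B n t) by exact: bigsetU_measurable.
  have mns s : measurable (node s t `+` cell E s).
    by have := mc s; have := mn s => ? ?; rewrite /setY; measset.
  have := pr_bigsetU0 (index_enum {: n.-tuple bool})
    (fun s => mns (true :: s)) (fun s => nE (true :: s)).
  have mEn := mE n; apply: pr0_le; first by rewrite /setY; measset.
    exact: bigsetU_measurable.
  move=> x; rewrite -bigcup_seq => -[[/BP[s sn sx] nEx]|[Ex nBx]].
    have /eqP sn' := sn; exists (Tuple sn'); first exact: mem_index_enum.
    by left; split => //= -[_]; rewrite sn.
  have [s sn sx] := cell_ex E n x.
  have /eqP sn' := sn; exists (Tuple sn'); first exact: mem_index_enum.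
  right; split; first by split => //; rewrite /= sn.
  by move=> sx'; apply: nBx; apply/BP; exists s.
exists B; split.
- move=> n; apply: set_path_bigsetU => s; by have [] := nodeP (true :: s).
- by move=> s t; rewrite -nodeE; have [] := nodeP s.
- by apply: endpoint => // s; have [] := nodeP s.
- by apply: endpoint => // s; have [] := nodeP s.
Qed.

End bits.

(** * Integrals of bounded functions along a weakly continuous path *)

Section bounded_integral.
Context d (X : measurableType d) (R : realType) (mu : probability X R).
Implicit Types f g : X -> R.

Definition bounded_measurable f :=
  measurable_fun setT f /\ exists M, forall x, `|f x| <= M.

Lemma bounded_measurable_integrable f : bounded_measurable f ->
  mu.-integrable setT (EFin \o f).
Proof.
move=> [mf [M fM]]; apply: measurable_bounded_integrable => //.
  by apply: (le_lt_trans (probability_le1 mu measurableT)); rewrite ltry.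
exists M; split; rewrite ?num_real // => x Mx y _ /=.
by rewrite (le_trans _ (ltW Mx)).
Qed.

Lemma bounded_measurable_cst (c : R) : bounded_measurable (fun=> c).
Proof. by split; [exact: measurable_cst|exists `|c|]. Qed.

Lemma bounded_measurableB f g : bounded_measurable f -> bounded_measurable g ->
  bounded_measurable (fun x => f x - g x).
Proof.
move=> [mf [M fM]] [mg [N gN]]; split; first exact: measurable_funB.
by exists (M + N) => x; apply: le_trans (ler_normB _ _) _; exact: lerD.
Qed.

Lemma bounded_measurableM f g : bounded_measurable f -> bounded_measurable g ->
  bounded_measurable (fun x => f x * g x).
Proof.
move=> [mf [M fM]] [mg [N gN]]; split; first exact: measurable_funM.
by exists (M * N) => x; rewrite normrM; exact: ler_pM.
Qed.

Lemma bounded_measurable_indic A : measurable A -> bounded_measurable \1_A.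
Proof.
move=> mA; split; first exact: measurable_indic.
by exists 1 => x; rewrite indicE; case: (_ \in _); rewrite ?normr1 ?normr0.
Qed.

Lemma le_integral_bounded f g : bounded_measurable f -> bounded_measurable g ->
  (forall x, f x <= g x) -> \int[mu]_x f x <= \int[mu]_x g x.
Proof.
by move=> bf bg fg; apply: le_Rintegral => //;
  exact: bounded_measurable_integrable.
Qed.

Lemma integral_boundedD f g : bounded_measurable f -> bounded_measurable g ->
  \int[mu]_x (f x + g x) = \int[mu]_x f x + \int[mu]_x g x.
Proof.
by move=> bf bg; rewrite RintegralD//; exact: bounded_measurable_integrable.
Qed.

Lemma integral_boundedB f g : bounded_measurable f -> bounded_measurable g ->
  \int[mu]_x (f x - g x) = \int[mu]_x f x - \int[mu]_x g x.
Proof.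
by move=> bf bg; rewrite RintegralB//; exact: bounded_measurable_integrable.
Qed.

Lemma integral_probability_cst (c : R) : \int[mu]_x c = c.
Proof.
by rewrite Rintegral_cst//; have := pr_setT mu; rewrite /pr => ->; rewrite mulr1.
Qed.

Lemma integral_pr A : measurable A -> \int[mu]_x (\1_A x : R) = pr mu A.
Proof. by move=> mA; rewrite /Rintegral integral_indic// setIT. Qed.

Lemma dist_integral_le f g h : bounded_measurable f -> bounded_measurable g ->
  bounded_measurable h -> (forall x, `|f x - g x| <= h x) ->
  `|\int[mu]_x f x - \int[mu]_x g x| <= \int[mu]_x h x.
Proof.
move=> bf bg bh fgh; rewrite -integral_boundedB//.
have bfg := bounded_measurableB bf bg.
apply: le_trans (le_normr_Rintegral _ _) _ => //.
  exact: bounded_measurable_integrable.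
apply: le_integral_bounded => //; have [mfg [M fgM]] := bfg; split.
  exact: measurableT_comp.
by exists M => x; rewrite normr_id.
Qed.

End bounded_integral.

Section borel.
Context (R : realType) (S : completeSeparableMetricType R).

Lemma continuous_borel_measurable (f : S -> R) : continuous f ->
  measurable_fun (setT : set (borelType S)) f.
Proof.
move=> cf; apply: (measurability _ (RGenOInfty.measurableE R)) => //.
move=> _ [_ [x ->] <-]; rewrite setTI; apply: sub_sigma_algebra.
by move/continuousP : cf; apply; exact: interval_open.
Qed.

Lemma continuous_bounded_measurable (f : S -> R) (M : R) : continuous f ->
  (forall x, `|f x| <= M) -> bounded_measurable (f : borelType S -> R).
Proof.
by move=> cf fM; split; [exact: continuous_borel_measurable|exists M].
Qed.

Context (T : topologicalType) (beta : T -> borel_probability R S).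
Hypothesis beta_continuous : continuous beta.
Local Notation E t f :=
  (\int[(beta t : probability (borelType S) R)]_x (f%FUN x)).

Lemma expectation_continuous (f : S -> R) (M : R) : continuous f ->
  (forall x, `|f x| <= M) -> continuous (fun t => E t f).
Proof.
move=> cf fM; have bf : bounded_fun f.
  exists M; split; rewrite ?num_real // => x Mx y _ /=.
  by rewrite (le_trans _ (ltW Mx)).
pose F : bounded_continuous S := exist _ f (conj cf bf).
move=> t; have ct : beta @ t --> beta t by exact: beta_continuous.
have cE := @cvg_comp _ _ _ beta (@expectations R S) _ (nbhs (beta t))
  (nbhs (expectations (beta t))) ct (@initial_continuous _ _ _ (beta t)).
exact: (@cvg_comp _ _ _ (@expectations R S \o beta) (@proj _ _ F) _
  (nbhs (expectations (beta t))) _ cE (@proj_continuous _ _ F _)).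
Qed.

(** Up to an error that is small in the mean, [W] is near [t0] independent of [t] and
    continuous in the variable of integration. This allows [W t0] to be
    discontinuous on a set which is negligible for [beta t0]. *)
Definition almost_continuous (W : T -> S -> R) :=
  [/\ forall t, measurable_fun (setT : set (borelType S)) (W t),
      forall t x, 0 <= W t x <= 1 &
      forall t0 e, 0 < e -> exists g h : S -> R,
        [/\ continuous g, forall x, 0 <= g x <= 1,
            continuous h, (exists M, forall x, `|h x| <= M) &
            E t0 h < e /\ \forall t \near t0, forall x, `|W t x - g x| <= h x]].

Lemma almost_continuous_bounded W t : almost_continuous W ->
  bounded_measurable (W t : borelType S -> R).
Proof.
move=> [mW W01 _]; split; first exact: mW.
by exists 1 => x; have /andP[W0 W1] := W01 t x; rewrite ger0_norm.
Qed.

Lemma almost_continuous_expectation W : almost_continuous W ->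
  continuous (fun t => E t (W t)).
Proof.
move=> aW; have [_ W01 cW] := aW; move=> t0; apply/cvgrPdist_lt => e e0.
have e40 : 0 < e / 4 by rewrite divr_gt0.
have [g [h [cg g01 ch [M hM] [he Wgh]]]] := cW t0 _ e40.
have g1 x : `|g x| <= 1 by have /andP[g0 ?] := g01 x; rewrite ger0_norm.
have bg := continuous_bounded_measurable cg g1.
have bh := continuous_bounded_measurable ch hM.
have cEg := expectation_continuous cg g1 (x := t0).
have cEh := expectation_continuous ch hM (x := t0).
have Wg t : (forall x, `|W t x - g x| <= h x) -> `|E t (W t) - E t g| <= E t h.
  by move=> Wt; apply: dist_integral_le => //; exact: almost_continuous_bounded.
have Wg0 := Wg t0 (nbhs_singleton Wgh).
near=> t.
have Wgt : `|E t (W t) - E t g| <= E t h by apply: Wg; near: t.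
have gt : `|E t0 g - E t g| < e / 4.
  by near: t; move/cvgrPdist_lt : cEg; exact.
have ht : `|E t0 h - E t h| < e / 4.
  by near: t; move/cvgrPdist_lt : cEh; exact.
move: Wg0 Wgt gt ht; rewrite !ler_norml !ltr_norml; lra.
Unshelve. all: by end_near. Qed.

Lemma almost_continuous1 : almost_continuous (fun _ _ => 1).
Proof.
split => [t|t x|t0 e e0]; [exact: measurable_cst|by rewrite ler01 lexx|].
exists (fun=> 1), (fun=> 0); split.
- exact: cst_continuous.
- by move=> x; rewrite ler01 lexx.
- exact: cst_continuous.
- by exists 0 => x; rewrite normr0.
- split; first by rewrite integral_probability_cst.
  by apply: nearW => t x; rewrite subrr normr0.
Qed.

Lemma almost_continuousC W : almost_continuous W ->
  almost_continuous (fun t x => 1 - W t x).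
Proof.
move=> [mW W01 cW]; split => [t|t x|t0 e e0].
- by apply: measurable_funB; [exact: measurable_cst|exact: mW].
- by have := W01 t x; lra.
- have [g [h [cg g01 ch hM [he Wgh]]]] := cW t0 _ e0.
  exists (fun x => 1 - g x), h; split => //.
  + by move=> x; apply: cvgB; [exact: cvg_cst|exact: cg].
  + by move=> x; have := g01 x; lra.
  + split => //; near=> t => x; have : `|W t x - g x| <= h x by move: x; near: t.
    by rewrite -normrN; congr (`|_| <= _); lra.
Unshelve. all: by end_near. Qed.

Lemma almost_continuousM W W' : almost_continuous W -> almost_continuous W' ->
  almost_continuous (fun t x => W t x * W' t x).
Proof.
move=> [mW W01 cW] [mW' W'01 cW']; split => [t|t x|t0 e e0].
- by apply: measurable_funM; [exact: mW|exact: mW'].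
- have /andP[? ?] := W01 t x; have /andP[? ?] := W'01 t x.
  by rewrite mulr_ge0//= mulr_ile1.
- have e20 : 0 < e / 2 by rewrite divr_gt0.
  have [g [h [cg g01 ch [M hM] [he Wgh]]]] := cW t0 _ e20.
  have [g' [h' [cg' g'01 ch' [M' hM'] [he' Wgh']]]] := cW' t0 _ e20.
  exists (fun x => g x * g' x), (fun x => h x + h' x); split.
  + by move=> x; apply: cvgM; [exact: cg|exact: cg'].
  + move=> x; have /andP[? ?] := g01 x; have /andP[? ?] := g'01 x.
    by rewrite mulr_ge0//= mulr_ile1.
  + by move=> x; apply: cvgD; [exact: ch|exact: ch'].
  + by exists (M + M') => x; apply: le_trans (ler_normD _ _) _; exact: lerD.
  + split.
      rewrite integral_boundedD; first by lra.
        exact: continuous_bounded_measurable ch hM.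
      exact: continuous_bounded_measurable ch' hM'.
    near=> t.
    have Wgt : forall x, `|W t x - g x| <= h x by near: t.
    have Wgt' : forall x, `|W' t x - g' x| <= h' x by near: t.
    move=> x; have Wt := Wgt x; have Wt' := Wgt' x.
    have -> : W t x * W' t x - g x * g' x =
        (W t x - g x) * W' t x + g x * (W' t x - g' x) by lra.
    apply: le_trans (ler_normD _ _) _; rewrite !normrM.
    have /andP[w0 w1] := W'01 t x; have /andP[g0 g1] := g01 x.
    rewrite (ger0_norm w0) (ger0_norm g0); apply: lerD.
      by apply: le_trans Wt; rewrite ler_piMr.
    by apply: le_trans Wt'; rewrite ler_piMl.
Unshelve. all: by end_near. Qed.

End borel.

(** * Softened indicators of superlevel sets *)

Section soft_indic.
Context (R : realType).
Implicit Types k v : R.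

(** Since [0 / 0 = 0], this is for [k = 0] the indicator of [0 < v]. The factor [2]
    and the cap make it [1] as soon as [0 < v] and [k <= v]. *)
Definition soft_indic k v : R :=
  Num.min 1 (2 * (Num.max 0 v / (Num.max 0 v + k))).

Let pos_ge0 v : 0 <= Num.max 0 v.
Proof. by rewrite le_max lexx. Qed.

Lemma soft_indic_ge0_le1 k v : 0 <= k -> 0 <= soft_indic k v <= 1.
Proof.
move=> k0; rewrite /soft_indic le_min ge_min lexx/= ler01/= andbT.
by rewrite mulr_ge0// divr_ge0// ?addr_ge0.
Qed.

Lemma soft_indic_le0 k v : v <= 0 -> soft_indic k v = 0.
Proof. by move=> v0; rewrite /soft_indic max_l// mul0r mulr0 min_r. Qed.

Lemma soft_indic_eq1 k v : 0 <= k <= v -> 0 < v -> soft_indic k v = 1.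
Proof.
move=> /andP[k0 kv] v0; rewrite /soft_indic max_r ?(ltW v0)// min_l//.
have vk : 0 < v + k by rewrite ltr_wpDr.
by rewrite mulrA ler_pdivlMr//; lra.
Qed.

Lemma soft_indic0 v : soft_indic 0 v = (0 < v)%R%:R.
Proof.
have [v0|v0] := ltP 0 v; last by rewrite soft_indic_le0.
by rewrite soft_indic_eq1// lexx ltW.
Qed.

Let dist_min1 (x y : R) : `|Num.min 1 x - Num.min 1 y| <= `|x - y|.
Proof.
have [x1|x1] := leP 1 x; have [y1|y1] := leP 1 y.
- by rewrite subrr normr0.
- by rewrite !ger0_norm; lra.
- by rewrite !ler0_norm; lra.
- by [].
Qed.

Lemma soft_indic_dist k k' v : 0 <= k -> 0 < k' ->
  `|soft_indic k v - soft_indic k' v| <= 2 * (`|k - k'| / k').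
Proof.
move=> k0 k'0; have [v0|v0] := leP v 0.
  by rewrite !soft_indic_le0// subrr normr0 mulr_ge0// divr_ge0// ltW.
apply: le_trans (dist_min1 _ _) _; rewrite max_r ?(ltW v0)//.
rewrite -mulrBr normrM ger0_norm// ler_pM2l//.
have vk : 0 < v + k by rewrite ltr_wpDr.
have vk' : 0 < v + k' by rewrite addr_gt0.
have -> : v / (v + k) - v / (v + k') = (k' - k) / (v + k') * (v / (v + k)).
  by field; rewrite !gt_eqF.
have c0 : 0 <= v / (v + k) by rewrite divr_ge0// ltW.
rewrite normrM (ger0_norm c0).
apply: (@le_trans _ _ (`|(k' - k) / (v + k')|)).
  by rewrite ler_piMr// ler_pdivrMr// mul1r lerDl.
rewrite normrM normfV distrC (gtr0_norm vk') ler_wpM2l//.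
by rewrite lef_pV2 ?posrE// lerDr ltW.
Qed.

Lemma soft_indic_dist0 k k' v : 0 <= k <= k' -> 0 < k' ->
  `|soft_indic k v - soft_indic k' v| <= 2 * (k' / (`|v| + k')).
Proof.
move=> /andP[k0 kk'] k'0; have [v0|v0] := leP v 0.
  by rewrite !soft_indic_le0// subrr normr0 mulr_ge0// divr_ge0 ?addr_ge0// ltW.
apply: le_trans (dist_min1 _ _) _; rewrite max_r ?(ltW v0)// (gtr0_norm v0).
rewrite -mulrBr normrM ger0_norm// ler_pM2l//.
have vk : 0 < v + k by rewrite ltr_wpDr.
have vk' : 0 < v + k' by rewrite addr_gt0.
have le1 : v / (v + k) <= 1 by rewrite ler_pdivrMr// mul1r lerDl.
have -> : k' / (v + k') = 1 - v / (v + k') by field; rewrite gt_eqF.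
rewrite ger0_norm; first by rewrite lerD2r.
by rewrite subr_ge0 ler_pM2l// lef_pV2 ?posrE// lerD2l.
Qed.

Lemma soft_indic_continuous k : 0 < k -> continuous (soft_indic k).
Proof.
move=> k0 v.
have cmax : Num.max 0 w @[w --> v] --> Num.max 0 v.
  exact: (@continuous_max _ _ (fun=> 0) id v (@cst_continuous _ _ _ _) (@cvg_id _ _)).
have cq : 2 * (Num.max 0 w / (Num.max 0 w + k)) @[w --> v] -->
    2 * (Num.max 0 v / (Num.max 0 v + k)).
  apply: cvgM; first exact: cvg_cst.
  apply: cvgM; first exact: cmax.
  apply: cvgV; first by rewrite gt_eqF// ltr_wpDl.
  by apply: cvgD; [exact: cmax|exact: cvg_cst].
exact: (@continuous_min _ _ (fun=> 1) _ v (@cst_continuous _ _ _ _) cq).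
Qed.

Lemma soft_indic_nondecreasing k : 0 <= k ->
  {homo soft_indic k : v w / v <= w}.
Proof.
move=> k0 v w vw; have [v0|v0] := leP v 0.
  by rewrite (soft_indic_le0 _ v0); have /andP[] := soft_indic_ge0_le1 w k0.
have w0 : 0 < w by exact: lt_le_trans vw.
rewrite /soft_indic !max_r ?(ltW v0) ?(ltW w0)//.
rewrite le_min ge_min lexx/= ge_min; apply/orP; right.
rewrite ler_pM2l// ler_pdivrMr ?ltr_wpDr// mulrAC ler_pdivlMr ?ltr_wpDr//.
by rewrite !mulrDr mulrC lerD2l ler_wpM2r.
Qed.

End soft_indic.

Section soft_superlevel.
Context (R : realType) (S : completeSeparableMetricType R).
Context (T : topologicalType) (beta : T -> borel_probability R S).
Local Notation E t f :=
  (\int[(beta t : probability (borelType S) R)]_x (f%FUN x)).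

(** The probability of [|v| < r] is small for small [r], and elsewhere the integrand
    is at most [2 * k / r]. *)
Lemma small_expectation (mu : probability (borelType S) R) (v : S -> R) (e : R) :
  continuous v -> pr mu [set x | v x = 0] = 0 -> 0 < e ->
  exists2 k, 0 < k & \int[mu]_x (2 * (k / (`|v x| + k))) < e.
Proof.
move=> cv v0 e0.
have mv := continuous_borel_measurable cv.
have mnv : measurable_fun (setT : set (borelType S)) (fun x => `|v x|).
  exact: measurableT_comp.
have mlt (c : R) : measurable ([set x | `|v x| < c] : set (borelType S)).
  rewrite (_ : [set x | _] = (fun x => `|v x|) @^-1` `]-oo, c[%classic).
    by rewrite -[X in measurable X]setTI; apply: mnv => //; exact: measurable_itv.
  by apply/seteqP; split => x; rewrite /= in_itv.
have [n nP] : exists n, pr mu [set x | `|v x| < n.+1%:R^-1] < e / 4.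
  apply: contrapT => nex.
  pose F n := ~` [set x | `|v x| < n.+1%:R^-1].
  have mF n : measurable (F n : set (borelType S)).
    by apply: measurableC; exact: mlt.
  have UF : \bigcup_n F n = ~` [set x | v x = 0].
    apply/seteqP; split => x.
      by move=> [n _ h] vx; apply: h; rewrite /= vx normr0 invr_gt0.
    move=> /= vx; have vx0 : 0 < `|v x| by rewrite normr_gt0; apply/eqP.
    have [n _ /(_ n (leqnn _))/= nv] := near_infty_natSinv_lt (PosNum vx0).
    exists n => //; apply/negP; rewrite -leNgt; exact: ltW.
  have mV : measurable ([set x | v x = 0] : set (borelType S)).
    rewrite -(setCK [set _ | _]) -UF; apply: measurableC.
    exact: bigcupT_measurable.
  have : pr mu (\bigcup_n F n) <= 1 - e / 4.
    apply: pr_bigcup_le => //.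
      apply/nondecreasing_seqP => n; apply/subsetPset => x /=; apply: contra_not.
      move=> /lt_le_trans; apply; rewrite lef_pV2 ?posrE//.
      by rewrite ler_nat.
    move=> n; rewrite /F pr_setC//; rewrite lerD2l lerN2 leNgt; apply/negP => h.
    by apply: nex; exists n.
  by rewrite UF pr_setC// v0; lra.
set r : R := n.+1%:R^-1 in nP; have r0 : 0 < r by rewrite invr_gt0.
pose k := r * (e / 4); have k0 : 0 < k by rewrite mulr_gt0// divr_gt0.
exists k => //.
have c0 x : 0 < `|v x| + k by rewrite ltr_wpDl.
pose f x := 2 * (k / (`|v x| + k)).
have f2 x : 0 <= f x <= 2.
  rewrite /f mulr_ge0 ?divr_ge0 ?(ltW k0) ?(ltW (c0 x))//=.
  by rewrite ler_piMr// ler_pdivrMr// mul1r lerDr.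
have cf : continuous f.
  move=> x; apply: cvgM; first exact: cvg_cst.
  apply: cvgM; first exact: cvg_cst.
  apply: cvgV; first by rewrite gt_eqF.
  by apply: cvgD; [apply: cvg_norm; exact: cv|exact: cvg_cst].
have bf : bounded_measurable (f : borelType S -> R).
  apply: (@continuous_bounded_measurable _ _ _ 2 cf) => x.
  by have /andP[f0 ?] := f2 x; rewrite ger0_norm.
pose A : set (borelType S) := [set x | `|v x| < r].
have bA := bounded_measurable_indic R (mlt r : measurable A).
have bA2 := bounded_measurableM (bounded_measurable_cst _ 2) bA.
have bg := bounded_measurableB bA2 (bounded_measurable_cst _ (- (e / 2))).
apply: (@le_lt_trans _ _ (\int[mu]_x (2 * \1_A x - - (e / 2)))).
  apply: le_integral_bounded => // x; rewrite -/(f x) indicE.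
  have [xA|xA] := boolP (x \in A).
    by rewrite -[X in 2 * X]/(1 : R); have /andP[_] := f2 x; move: e0; lra.
  have rv : r <= `|v x| by move: xA; rewrite notin_setE /A /= => /negP; rewrite -leNgt.
  rewrite mulr0 sub0r opprK /f.
  have -> : e / 2 = 2 * (e / 4) by lra.
  rewrite ler_pM2l// ler_pdivrMr// /k mulrC ler_pM2l ?divr_gt0//.
  by rewrite (le_trans rv)// lerDl mulrC ltW.
rewrite integral_boundedB//; last exact: bounded_measurable_cst.
rewrite integral_probability_cst RintegralZl//; last exact: bounded_measurable_integrable.
rewrite integral_pr; last exact: mlt.
by move: nP; rewrite /A; lra.
Qed.

(** Where [kappa] does not vanish, [soft_indic (kappa t)] depends on [t]
    continuously, uniformly in its argument; where it vanishes, it is compared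
    with [soft_indic k] for a small [k > 0], from which it differs much only near
    the level set [v = 0]. *)
Lemma soft_indic_almost_continuous (kappa : T -> R) (v : S -> R) :
  continuous kappa -> (forall t, 0 <= kappa t) -> continuous v ->
  (forall t, kappa t = 0 -> pr (beta t) [set x | v x = 0] = 0) ->
  almost_continuous beta (fun t x => soft_indic (kappa t) (v x)).
Proof.
move=> ck k0 cv v0; split => [t|t x|t0 e e0].
- apply: (@measurableT_comp _ _ _ _ _ _ (soft_indic (kappa t))).
    by apply: nondecreasing_measurable => // x y; exact: soft_indic_nondecreasing.
  exact: continuous_borel_measurable.
- exact: soft_indic_ge0_le1.
- have cH k : 0 < k -> continuous (fun x => soft_indic k (v x)).
    by move=> k'0 x; apply: cvg_comp; [exact: cv|exact: soft_indic_continuous].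
  have [kt0|kt0] := ltP 0 (kappa t0).
    exists (fun x => soft_indic (kappa t0) (v x)), (fun=> e / 2); split.
    + exact: cH.
    + by move=> x; exact: soft_indic_ge0_le1.
    + exact: cst_continuous.
    + by exists `|e / 2|.
    + split; first by rewrite integral_probability_cst; lra.
      have d0 : 0 < kappa t0 * (e / 4) by rewrite mulr_gt0// divr_gt0.
      have ckt := ck t0; move/cvgrPdist_lt : ckt => /(_ _ d0) near_k.
      near=> t => x; apply: le_trans (soft_indic_dist _ (k0 t) kt0) _.
      have kt : `|kappa t0 - kappa t| < kappa t0 * (e / 4) by near: t.
      have -> : e / 2 = 2 * (e / 4) by lra.
      by rewrite ler_pM2l// ler_pdivrMr// mulrC distrC ltW.
  have kt0E : kappa t0 = 0 by apply/eqP; rewrite eq_le kt0 k0.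
  have [k kp ke] := small_expectation cv (v0 _ kt0E) e0.
  have c0 x : 0 < `|v x| + k by rewrite ltr_wpDl.
  exists (fun x => soft_indic k (v x)), (fun x => 2 * (k / (`|v x| + k))); split.
  + exact: cH.
  + by move=> x; apply: soft_indic_ge0_le1; exact: ltW.
  + move=> x; apply: cvgM; first exact: cvg_cst.
    apply: cvgM; first exact: cvg_cst.
    apply: cvgV; first by rewrite gt_eqF.
    by apply: cvgD; [apply: cvg_norm; exact: cv|exact: cvg_cst].
  + exists 2 => x; rewrite ger0_norm; last first.
      by rewrite mulr_ge0 ?divr_ge0 ?(ltW kp) ?(ltW (c0 x)).
    by rewrite ler_piMr// ler_pdivrMr// mul1r lerDr.
  + split => //; have ckt := ck t0; move/cvgrPdist_lt : ckt => /(_ _ kp) near_k.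
    near=> t => x; apply: soft_indic_dist0 => //; rewrite k0/=.
    have : `|kappa t0 - kappa t| < k by near: t.
    by rewrite kt0E sub0r normrN ger0_norm// => /ltW.
Unshelve. all: by end_near. Qed.

End soft_superlevel.

(** * Balls with negligible boundary *)

Section atoms.
Context d (X : measurableType d) (R : realType) (mu : probability X R).
Variable f : X -> R.
Hypothesis mf : measurable_fun setT f.

Let mlevel (r : R) : measurable [set x | f x = r].
Proof.
rewrite (_ : [set x | _] = f @^-1` [set r])//.
by rewrite -[X in measurable X]setTI; apply: mf.
Qed.

Let finite_atoms (c : R) : 0 < c ->
  finite_set [set r | c <= pr mu [set x | f x = r]].
Proof.
move=> c0; apply: contrapT => /infiniteP/pcard_leP[g].
pose U n := \big[setU/set0]_(k < n) [set x | f x = g k].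
have mU n : measurable (U n) by apply: bigsetU_measurable.
have prU_ge n : n%:R * c <= pr mu (U n).
  elim: n => [|n IH]; first by rewrite mul0r pr_ge0.
  have -> : U n.+1 = U n `|` [set x | f x = g n] by rewrite /U big_ord_recr.
  rewrite prU; [|exact: mU|exact: mlevel|].
    have gn : c <= pr mu [set x | f x = g n] by exact: (@funS _ _ _ _ g n I).
    by rewrite -natr1 mulrDl mul1r lerD.
  apply/seteqP; split => // x [].
  rewrite /U -(bigcup_mkord n (fun k => [set x | f x = g k])) => -[k /= kn fk] fn.
  have : g k = g n by rewrite -fk -fn.
  move=> /(@inj _ _ _ g k n (mem_set I) (mem_set I)) kE.
  by rewrite kE ltnn in kn.
have [n nc] : exists n, c^-1 < n%:R.
  by exists (Num.trunc c^-1).+1; exact: truncnS_gt.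
have := prU_ge n; apply/negP; rewrite -ltNge.
apply: (@le_lt_trans _ _ 1).
  by rewrite -(pr_setT mu); apply: le_pr.
by rewrite -ltr_pdivrMr// mul1r.
Qed.

(** Level sets being disjoint, only finitely many have a probability of at least
    a given [c > 0]. *)
Lemma countable_atoms : countable [set r | pr mu [set x | f x = r] != 0].
Proof.
have -> : [set r | pr mu [set x | f x = r] != 0] =
    \bigcup_n [set r | n.+1%:R^-1 <= pr mu [set x | f x = r]].
  apply/seteqP; split => r /=.
    move=> r0.
    have p0 : 0 < pr mu [set x | f x = r] by rewrite lt_neqAle eq_sym r0 pr_ge0.
    have [n _ /(_ n (leqnn _))/= nr] := near_infty_natSinv_lt (PosNum p0).
    by exists n => //=; exact: ltW.
  by move=> [n _ /=] h; rewrite gt_eqF// (lt_le_trans _ h)// invr_gt0.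
apply: bigcup_countable => // n _; apply: finite_set_countable.
by apply: finite_atoms; rewrite invr_gt0.
Qed.

End atoms.

Lemma negligible_level d (X : measurableType d) (R : realType)
    (mu0 mu1 : probability X R) (f : X -> R) (a b : R) :
  measurable_fun setT f -> a < b -> exists2 r, a < r < b &
    pr mu0 [set x | f x = r] = 0 /\ pr mu1 [set x | f x = r] = 0.
Proof.
move=> mf ab; apply: contrapT => nr.
pose D := [set r | pr mu0 [set x | f x = r] != 0] `|`
  [set r | pr mu1 [set x | f x = r] != 0].
have cD : countable D.
  by rewrite /D -bigcup2E; apply: bigcup_countable => // -[|[|n]] _ //=;
    exact: countable_atoms.
have abD : `]a, b[%classic `<=` D.
  move=> r /=; rewrite in_itv/= => rab; apply: contrapT => /not_orP[/= r0 r1].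
  apply: nr; exists r => //; split; apply/eqP; apply: contrapT.
    by move=> h; apply: r0; apply/negP.
  by move=> h; apply: r1; apply/negP.
have := countable_lebesgue_measure0 (sub_countable (subset_card_le abD) cD).
rewrite lebesgue_measure_itv/= lte_fin ab -EFinD => /eqP.
by rewrite eqe subr_eq0 gt_eqF.
Qed.

Section net.
Context (R : realType) (S : completeSeparableMetricType R).
Implicit Types (x y z : S).

Lemma mdist_continuous x : continuous (mdist x : S -> R).
Proof.
move=> y; apply/cvgrPdist_lt => e e0; near=> z.
have : ball y e z by near: z; exact: nbhsx_ballx.
rewrite ballEmdist/= => yz; apply: le_lt_trans yz.
rewrite ler_norml; have := metric_triangle x y z; have := metric_triangle x z y.
by rewrite (metric_sym z y); lra.
Unshelve. all: by end_near. Qed.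

Lemma dense_sequence : exists q : nat -> S,
  forall x (e : R), 0 < e -> exists k, mdist (q k) x < e.
Proof.
have [D cD dD] : exists2 D : set S, countable D & dense D.
  exact: separable_dense.
have [f finj] := countable_injP D cD.
have /choice[q qP] k : exists y, forall x, D x -> f x = k -> y = x.
  have [[x [Dx <-]]|nk] := pselect (exists x, D x /\ f x = k).
    exists x => x' Dx' ff; apply: finj => //; exact: mem_set.
  by exists point => x Dx fx; exfalso; apply: nk; exists x.
exists q => x e e0.
have ob : open (ball x e).
  rewrite openE => y; rewrite ballEmdist/= => xy.
  apply/nbhs_ballP; exists (e - mdist x y) => /=; first by rewrite subr_gt0.
  move=> z; rewrite !ballEmdist/= => yz.
  by have := metric_triangle x y z; lra.
have [y [xy Dy]] := dD _ (ex_intro _ x (ballxx x e0)) ob.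
exists (f y); rewrite (qP _ y)//.
have : ball x e y by exact: xy.
by rewrite ballEmdist/= metric_sym.
Qed.

(** The balls of small radius cover the space even if all radii are halved, which
    leaves room for weights that are [1] on the halved balls and continuous. *)
Lemma negligible_net (mu0 mu1 : probability (borelType S) R) :
  exists (q : nat -> S) (rho : nat -> R), [/\ forall n, 0 < rho n,
    forall x e, 0 < e -> exists n, rho n < e /\ mdist (q n) x < rho n / 2 &
    forall n, pr mu0 [set x | mdist (q n) x = rho n] = 0 /\
      pr mu1 [set x | mdist (q n) x = rho n] = 0].
Proof.
have [p pP] := dense_sequence.
pose km n : nat * nat := odflt (0, 0)%N (unpickle n).
pose e m : R := m.+1%:R^-1.
have e0 m : 0 < e m by rewrite invr_gt0.
have /choice[rho rhoP] n : exists r, [/\ e (km n).2 / 2 < r < e (km n).2,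
    pr mu0 [set x | mdist (p (km n).1) x = r] = 0 &
    pr mu1 [set x | mdist (p (km n).1) x = r] = 0].
  have mp := continuous_borel_measurable (@mdist_continuous (p (km n).1)).
  have ee : e (km n).2 / 2 < e (km n).2 by have := e0 (km n).2; lra.
  by have [r rr []] := negligible_level mu0 mu1 mp ee; exists r.
exists (fun n => p (km n).1), rho; split.
- by move=> n; have [/andP[h _] _ _] := rhoP n; have := e0 (km n).2; lra.
- move=> x r r0.
  have [m _ /(_ m (leqnn _))/= mr] := near_infty_natSinv_lt (PosNum r0).
  have {}mr : e m < r := mr.
  have em4 : 0 < e m / 4 by have := e0 m; lra.
  have [k kx] := pP x _ em4.
  exists (pickle (k, m)); have [] := rhoP (pickle (k, m)).
  rewrite /km pickleK /= => /andP[h1 h2] _ _; split; first exact: lt_trans mr.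
  by apply: lt_trans kx _; lra.
- by move=> n; have [] := rhoP n.
Qed.

End net.

(** * Events whose joint probabilities are mixtures of products *)

Section weight.
Context (R : realType) (X : Type) (psi : nat -> X -> R).

(** The conditional probability, given a point [x], of the cell [s] of events that
    are conditionally independent with probabilities [psi n x]. *)
Fixpoint weight (s : seq bool) (x : X) : R :=
  if s is b :: s' then
    weight s' x * (if b then psi (size s') x else 1 - psi (size s') x)
  else 1.

(** Marginals of [cell] and [weight]: the bits with [c k = None] are left free,
    and the indices run through [n <= k < n + m] upwards, so that they can follow
    a cell with [n] bits. *)
Fixpoint constrained_event (Y : Type) (b : nat -> set Y)
    (c : nat -> option bool) (n m : nat) : set Y :=
  if m is m'.+1 then
    (if c n is Some e then if e then b n else ~` b n else setT) `&`
      constrained_event b c n.+1 m'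
  else setT.

Fixpoint constrained_weight (c : nat -> option bool) (n m : nat) (x : X) : R :=
  if m is m'.+1 then
    (if c n is Some e then if e then psi n x else 1 - psi n x else 1) *
      constrained_weight c n.+1 m' x
  else 1.

Lemma constrained_eventP (Y : Type) (b : nat -> set Y) c n m y :
  constrained_event b c n m y <-> forall k, (n <= k < n + m)%N ->
    (if c k is Some e then if e then b k else ~` b k else setT) y.
Proof.
elim: m n => [|m IH] n /=; first by split => // _ k; rewrite addn0; lia.
split=> [[bn /IH h] k nk|h].
  by have [<-//|nk'] := eqVneq n k; apply: h; lia.
by split; [apply: h; lia|apply/IH => k nk; apply: h; lia].
Qed.

Hypothesis psi01 : forall n x, 0 <= psi n x <= 1.

Lemma constrained_weight01 c n m x : 0 <= constrained_weight c n m x <= 1.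
Proof.
elim: m n => [|m IH] n /=; first by rewrite ler01 lexx.
have /andP[h0 h1] := IH n.+1; have /andP[p0 p1] := psi01 n x.
set l := (X in X * _).
have /andP[l0 l1] : 0 <= l <= 1.
  by rewrite /l; case: (c n) => [[]|]; rewrite ?p0 ?p1 ?ler01 ?lexx//; lra.
by rewrite mulr_ge0//= mulr_ile1.
Qed.

Lemma constrained_weight_eq0 c n m x k : (n <= k < n + m)%N ->
  (if c k is Some e then if e then psi k x else 1 - psi k x else 1) = 0 ->
  constrained_weight c n m x = 0.
Proof.
elim: m n => [|m IH] n nk ck0 /=; first lia.
have [nE|nk'] := eqVneq n k; first by rewrite nE ck0 mul0r.
by rewrite IH ?mulr0//; lia.
Qed.

Lemma constrained_weight_eq1 c n m x :
  (forall k, (if c k is Some e then if e then psi k x else 1 - psi k x else 1)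
    = 1) -> constrained_weight c n m x = 1.
Proof. by move=> c1; elim: m n => [//|m IH] n /=; rewrite c1 IH mulr1. Qed.

End weight.

Section mixture.
Context (R : realType) d (Omega : measurableType d) (P : probability Omega R).
Context d' (X : measurableType d') (mu : probability X R).
Variables (psi : nat -> X -> R) (b : nat -> set Omega).
Hypotheses (psi01 : forall n x, 0 <= psi n x <= 1)
  (mpsi : forall n, measurable_fun setT (psi n))
  (mb : forall n, measurable (b n))
  (b_weight : forall s, pr P (cell b s) = \int[mu]_x weight psi s x).

Let bounded_psi n : bounded_measurable (psi n).
Proof.
split => //; exists 1 => x; have /andP[p0 p1] := psi01 n x.
by rewrite ger0_norm.
Qed.

Let bounded_lit (o : option bool) n :
  bounded_measurable (fun x =>
    if o is Some e then if e then psi n x else 1 - psi n x else 1).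
Proof.
case: o => [[]|]; [exact: bounded_psi| |exact: bounded_measurable_cst].
by apply: bounded_measurableB; [exact: bounded_measurable_cst|].
Qed.

Let bounded_weight s : bounded_measurable (weight psi s).
Proof.
elim: s => [|e s IH] /=; first exact: bounded_measurable_cst.
by apply: bounded_measurableM => //; exact: (bounded_lit (Some e)).
Qed.

Let bounded_constrained c n m :
  bounded_measurable (constrained_weight psi c n m).
Proof.
elim: m n => [|m IH] n /=; first exact: bounded_measurable_cst.
by apply: bounded_measurableM.
Qed.

Let measurable_constrained c n m : measurable (constrained_event b c n m).
Proof.
elim: m n => [|m IH] n /=; first exact: measurableT.
apply: measurableI => //; case: (c n) => [[]|]; [exact: mb| |exact: measurableT].
by apply: measurableC; exact: mb.
Qed.

(** By induction on the number of indices left, after an arbitrary cell: a free bit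
    is summed out over the two refinements of the cell. *)
Lemma constrained_probability c m :
  pr P (constrained_event b c 0 m) = \int[mu]_x constrained_weight psi c 0 m x.
Proof.
suff H s : pr P (cell b s `&` constrained_event b c (size s) m) =
    \int[mu]_x (weight psi s x * constrained_weight psi c (size s) m x).
  have := H [::]; rewrite /= setTI => ->.
  by congr fine; apply: eq_integral => x _; rewrite mul1r.
elim: m s => [|m IH] s /=.
  rewrite setIT b_weight; congr fine; apply: eq_integral => x _.
  by rewrite mulr1.
case cE: (c (size s)) => [e|].
  have /= := IH (e :: s); rewrite setIA => ->.
  by congr fine; apply: eq_integral => x _; rewrite mulrA.
rewrite setTI.
have /= Ht := IH (true :: s); have /= Hf := IH (false :: s).
set C := constrained_event b c (size s).+1 m in Ht Hf *.
have mC : measurable C by exact: measurable_constrained.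
have mc : measurable (cell b s) by exact: cell_measurable.
have mbs := mb (size s).
have -> : cell b s `&` C =
    (cell b s `&` b (size s) `&` C) `|` (cell b s `&` ~` b (size s) `&` C).
  by apply/seteqP; split => y; have := EM (b (size s) y); sett.
rewrite prU; [|by measset|by measset|]; last first.
  by apply/seteqP; split => // y; sett.
rewrite Ht Hf -integral_boundedD.
- congr fine; apply: eq_integral => x _; congr EFin; ring.
- apply: bounded_measurableM => //; apply: bounded_measurableM => //.
- apply: bounded_measurableM => //; apply: bounded_measurableM => //.
  exact: (bounded_lit (Some false)).
Qed.

Lemma pr_setI_bits n k : (forall x, psi n x * psi k x = 0) -> n != k ->
  pr P (b n `&` b k) = 0.
Proof.
move=> psi0 nk.
pose c i := if (i == n) || (i == k) then Some true else None.
pose m := (maxn n k).+1.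
have -> : b n `&` b k = constrained_event b c 0 m.
  apply/seteqP; split => y.
    move=> [bn bk]; apply/constrained_eventP => i _; rewrite /c.
    have [->//|/= _] := eqVneq i n.
    by have [->|] := eqVneq i k.
  move=> /constrained_eventP h; split.
    have := h n; rewrite /c eqxx /=; apply; rewrite /m; lia.
  by have := h k; rewrite /c eqxx orbT /=; apply; rewrite /m; lia.
rewrite constrained_probability -(@integral_probability_cst _ _ _ mu 0).
congr fine; apply: eq_integral => x _; congr EFin.
have /eqP := psi0 x; rewrite mulf_eq0 => /orP[/eqP p0|/eqP p0].
  by apply: (@constrained_weight_eq0 _ _ _ _ _ _ _ n); rewrite /m /c ?eqxx//; lia.
by apply: (@constrained_weight_eq0 _ _ _ _ _ _ _ k);
  rewrite /m /c ?eqxx ?orbT//; lia.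
Qed.

Let none (J : pred nat) m := constrained_event b
  (fun n => if J n then Some false else None) 0 m.

Let noneE (J : pred nat) m :
  ~` none J m = \bigcup_(n in [set n | (n < m)%N && J n]) b n.
Proof.
apply/seteqP; split => y.
  move=> nb; apply: contrapT => nU; apply: nb; apply/constrained_eventP => k km.
  case: ifP => // Jk bk; apply: nU; exists k => //=; exact/andP.
move=> [n /= /andP[nm Jn] bn] /constrained_eventP /(_ n); rewrite Jn; apply => //.
Qed.

Let measurable_some (J : pred nat) m :
  measurable (\bigcup_(n in [set n | (n < m)%N && J n]) b n).
Proof. by apply: bigcup_measurable => k _; exact: mb. Qed.

Let pr_some (J : pred nat) m :
  pr P (\bigcup_(n in [set n | (n < m)%N && J n]) b n) =
  1 - \int[mu]_x constrained_weight psi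
    (fun n => if J n then Some false else None) 0 m x.
Proof.
by rewrite -noneE pr_setC ?constrained_probability//; exact: measurable_constrained.
Qed.

(** If all weights with index in [J] vanish at a point outside of [Q], all these bits
    are almost surely [false] for that point. *)
Lemma pr_bigcup_bits_le (J : pred nat) (Q : set X) : measurable Q ->
  (forall n x, J n -> ~ Q x -> psi n x = 0) ->
  pr P (\bigcup_(n in [set n | J n]) b n) <= pr mu Q.
Proof.
move=> mQ psiQ.
have -> : \bigcup_(n in [set n | J n]) b n =
    \bigcup_m \bigcup_(n in [set n | (n < m)%N && J n]) b n.
  apply/seteqP; split => y.
    by move=> [n /= Jn bn]; exists n.+1 => //; exists n; rewrite //= ltnS leqnn.
  by move=> [m _ [n /= /andP[_ Jn] bn]]; exists n.
apply: pr_bigcup_le => //.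
  apply/nondecreasing_seqP => m; apply/subsetPset => y [n /= /andP[nm Jn] bn].
  by exists n => //=; rewrite Jn ltnS ltnW.
move=> m; rewrite pr_some lerBlDr -lerBlDl -pr_setC//.
rewrite -integral_pr; last exact: measurableC.
apply: le_integral_bounded => //.
  by apply: bounded_measurable_indic; exact: measurableC.
move=> x; rewrite indicE; case: (boolP (x \in _)) => [|_]; last first.
  by have /andP[] := constrained_weight01 psi01
    (fun n => if J n then Some false else None) 0 m x.
rewrite inE /= => nQ; rewrite constrained_weight_eq1//.
by move=> k; case: ifP => // Jk; rewrite psiQ// subr0.
Qed.

(** The points for which one of finitely many weights is [1] fill the space up to a
    small probability. *)
Lemma pr_bigcup_bits_gt (J : pred nat) (e : R) : 0 < e ->
  (forall x, exists2 n, J n & psi n x = 1) ->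
  exists m, 1 - e < pr P (\bigcup_(n in [set n | (n < m)%N && J n]) b n).
Proof.
move=> e0 psi1; apply: contrapT => nm.
pose U m := \bigcup_(n in [set n | (n < m)%N && J n]) (psi n @^-1` [set 1]).
have mU m : measurable (U m).
  apply: bigcup_measurable => k _.
  by rewrite -[X in measurable X]setTI; apply: mpsi.
have : pr mu (\bigcup_m U m) <= 1 - e.
  apply: pr_bigcup_le => //.
    apply/nondecreasing_seqP => m; apply/subsetPset => y [n /= /andP[n_m Jn] bn].
    by exists n => //=; rewrite Jn ltnS ltnW.
  move=> m; apply: (@le_trans _ _
      (pr P (\bigcup_(n in [set n | (n < m)%N && J n]) b n))); last first.
    by rewrite leNgt; apply/negP => h; apply: nm; exists m.
  rewrite pr_some lerBrDr -lerBrDl -pr_setC//.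
  rewrite -integral_pr; last exact: measurableC.
  apply: le_integral_bounded => //.
    by apply: bounded_measurable_indic; exact: measurableC.
  move=> x; rewrite indicE; case: (boolP (x \in _)) => [_|].
    by have /andP[] := constrained_weight01 psi01
      (fun n => if J n then Some false else None) 0 m x.
  rewrite notin_setE => /contrapT -[n /= /andP[n_m Jn] p1].
  by rewrite (@constrained_weight_eq0 _ _ _ _ _ _ _ n)// Jn p1 subrr.
rewrite (_ : \bigcup_m U m = setT) ?pr_setT; first by lra.
apply/seteqP; split => // x _; have [n Jn p1] := psi1 x.
by exists n.+1 => //; exists n => //=; rewrite ltnS leqnn.
Qed.

End mixture.

(** * Random points encoded by the balls that contain them *)

Section decode.
Context (R : realType) (S : completeSeparableMetricType R).
Context d (Omega : measurableType d) (P : probability Omega R).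
Context (mu : probability (borelType S) R).
Variables (q : nat -> S) (rho : nat -> R) (psi : nat -> S -> R).
Variable b : nat -> set Omega.
Hypotheses (rho_gt0 : forall n, 0 < rho n)
  (netP : forall x e, 0 < e -> exists n, rho n < e /\ mdist (q n) x < rho n / 2).
Hypotheses (psi01 : forall n x, 0 <= psi n x <= 1)
  (mpsi : forall n, measurable_fun (setT : set (borelType S)) (psi n))
  (psi_out : forall n x, rho n <= mdist (q n) x -> psi n x = 0)
  (psi_in : forall n x, mdist (q n) x < rho n / 2 -> psi n x = 1).
Hypotheses (mb : forall n, measurable (b n))
  (b_weight : forall s, pr P (cell b s) =
    \int[mu]_x weight (psi : nat -> borelType S -> R) s x).

Let pr_no_small_ball e c : 0 < e -> 0 < c -> exists m,
  1 - c < pr P (\bigcup_(n in [set n | (n < m)%N && (rho n < e)]) b n).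
Proof.
move=> e0 c0; apply: (pr_bigcup_bits_gt (mu := mu) psi01 mpsi mb b_weight c0) => x.
by have [n [ne nx]] := netP x e0; exists n => //; exact: psi_in.
Qed.

(** The conditions under which the balls of the bits that are [true] have a common
    point, and only one, once their closures are taken. *)
Definition decodable w := (forall e, 0 < e -> exists2 n, rho n < e & b n w) /\
  forall n k, b n w -> b k w -> mdist (q n) (q k) < rho n + rho k.

Lemma decodable_ae : exists N, [/\ measurable N, pr P N = 0 &
  forall w, ~ N w -> decodable w].
Proof.
pose F1 k := ~` \bigcup_(n in [set n | rho n < k.+1%:R^-1]) b n.
have mF1 k : measurable (F1 k).
  by apply: measurableC; apply: bigcup_measurable => n _; exact: mb.
have F1_0 k : pr P (F1 k) = 0.
  have k0 : 0 < k.+1%:R^-1 :> R by rewrite invr_gt0.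
  apply/eqP; rewrite eq_le pr_ge0 andbT; apply/ler_addgt0Pl => c c0.
  rewrite addr0; have [m mc] := pr_no_small_ball k0 c0.
  have mU : measurable (\bigcup_(n in [set n | rho n < k.+1%:R^-1]) b n).
    by apply: bigcup_measurable => n _; exact: mb.
  rewrite /F1 pr_setC// lerBlDr -lerBlDl; apply: le_trans (ltW mc) _.
  apply: le_pr => //; first by apply: bigcup_measurable => n _; exact: mb.
  by move=> w [n /= /andP[_ nk] bn]; exists n.
pose F2 i := if unpickle i is Some (n, k) then
  if rho n + rho k <= mdist (q n) (q k) then b n `&` b k else set0 else set0.
have mF2 i : measurable (F2 i).
  rewrite /F2; case: (unpickle i) => [[n k]|]; last exact: measurable0.
  by case: ifP => _; [apply: measurableI|exact: measurable0].
have F2_0 i : pr P (F2 i) = 0.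
  rewrite /F2; case: (unpickle i) => [[n k]|]; last exact: pr_set0.
  case: ifPn => [far|_]; last exact: pr_set0.
  apply: (pr_setI_bits (mu := mu) psi01 mpsi mb b_weight).
    move=> x; have [nx|nx] := leP (rho n) (mdist (q n) x).
      by rewrite psi_out// mul0r.
    rewrite (@psi_out k x) ?mulr0//; have := metric_triangle (q n) x (q k).
    by rewrite (metric_sym x); lra.
  apply/eqP => nk; move: far; rewrite nk mdistxx.
  by have := rho_gt0 k; lra.
exists (\bigcup_k F1 k `|` \bigcup_i F2 i); split.
- by apply: measurableU; exact: bigcupT_measurable.
- apply/eqP; rewrite eq_le pr_ge0 andbT -(addr0 0).
  rewrite -{1}(pr_bigcup0 mF1 F1_0) -(pr_bigcup0 mF2 F2_0).
  by apply: prU_le; exact: bigcupT_measurable.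
- move=> w /not_orP[n1 n2]; split => [e e0|n k bn bk].
    have [k _ /(_ k (leqnn _))/= ke] := near_infty_natSinv_lt (PosNum e0).
    have : ~ F1 k w by move=> h; apply: n1; exists k.
    move=> /contrapT[n /= nk bn]; exists n => //; exact: lt_trans ke.
  rewrite ltNge; apply/negP => far; apply: n2; exists (pickle (n, k)) => //.
  by rewrite /F2 pickleK far.
Qed.

Definition decodes w z := forall n, b n w -> mdist (q n) z <= rho n.

Lemma decodable_ex w : decodable w -> exists z, decodes w z.
Proof.
move=> [small compat].
have /choice[n nP] (k : nat) : exists n, rho n < k.+1%:R^-1 /\ b n w.
  have k0 : 0 < k.+1%:R^-1 :> R by rewrite invr_gt0.
  by have [n nk bn] := small _ k0; exists n.
pose u k : S := q (n k).
have uu k i : mdist (u k) (u i) < k.+1%:R^-1 + i.+1%:R^-1.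
  have [[nk bk] [ni bi]] := (nP k, nP i).
  by apply: lt_trans (compat _ _ bk bi) _; exact: ltrD.
have cu : cvg (u @ \oo).
  apply: cauchy_cvg; apply: cauchy_exP => e e0.
  have e20 : 0 < e / 2 by rewrite divr_gt0.
  have [k _ kP] := near_infty_natSinv_lt (PosNum e20).
  exists (u k), k => // i /= ki; rewrite ballEmdist/=.
  apply: lt_trans (uu k i) _; have hk : k.+1%:R^-1 < e / 2 := kP k (leqnn _).
  have hi : i.+1%:R^-1 < e / 2 := kP i ki.
  by move: hi hk; move: (i.+1%:R^-1) (k.+1%:R^-1) => x y; lra.
exists (lim (u @ \oo)) => j bj; apply/ler_addgt0Pl => e e0.
have e20 : 0 < e / 2 by rewrite divr_gt0.
have near_lim : \forall i \near \oo, mdist (lim (u @ \oo)) (u i) < e / 2.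
  have : \forall i \near \oo, ball (lim (u @ \oo)) (e / 2) (u i).
    exact: (cu _ (nbhsx_ballx _ _ e20)).
  by apply: filterS => i; rewrite ballEmdist.
near \oo => i.
have h1 : mdist (lim (u @ \oo)) (u i) < e / 2 by near: i.
have h2 : (i.+1%:R^-1 : R) < e / 2.
  by near: i; exact: (near_infty_natSinv_lt (PosNum e20)).
have [ni bi] := nP i; have h3 := compat _ _ bj bi.
have := metric_triangle (q j) (u i) (lim (u @ \oo)).
rewrite (metric_sym (u i)) /u; rewrite /u in h1.
by move: (i.+1%:R^-1) ni h1 h2 h3 => r; lra.
Unshelve. all: by end_near. Qed.

Lemma decodes_uniq w z z' : decodable w -> decodes w z -> decodes w z' -> z = z'.
Proof.
move=> [small _] zP z'P; apply: mdist_positivity; apply/eqP.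
rewrite eq_le mdist_ge0 andbT; apply/ler_addgt0Pl => e e0; rewrite addr0.
have e20 : 0 < e / 2 by rewrite divr_gt0.
have [n ne bn] := small _ e20.
have := zP n bn; have := z'P n bn; have := metric_triangle z (q n) z'.
by rewrite (metric_sym z (q n)); lra.
Qed.

Let ball_open (x : S) (e : R) : open [set y | mdist x y < e].
Proof.
have /continuousP/(_ `]-oo, e[%classic (interval_open _ _)) :=
  @mdist_continuous _ _ x.
rewrite (_ : _ @^-1` _ = [set y | mdist x y < e]); first by apply.
by apply/seteqP; split => y; rewrite /= in_itv.
Qed.

(** The law of the decoded point is compared with [mu] on closed sets [F]: the
    weight of a small ball that meets [F] is supported in a thickening of [F].
    Applied to complements and to closed sets exhausting an open one, this gives
    equality on open sets. *)
Lemma decode_ex : exists Z : Omega -> S,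
  [/\ measurable_fun setT (Z : Omega -> borelType S),
      (exists N, [/\ measurable N, pr P N = 0 &
        forall w, ~ N w -> decodable w /\ decodes w (Z w)]) &
      forall A : set (borelType S), measurable A -> pr P (Z @^-1` A) = pr mu A].
Proof.
have [N [mN N0 NP]] := decodable_ae.
have /choice[Z ZP] w : exists z, (~ N w -> decodes w z) /\ (N w -> z = point).
  have [Nw|nNw] := pselect (N w); first by exists point.
  by have [z zP] := decodable_ex (NP w nNw); exists z.
have ZoutN w : ~ N w -> decodes w (Z w) by have [] := ZP w.
(* [Z] is measurable because small selected balls decide whether it is in [G] *)
have Zopen (G : set S) : open G -> Z @^-1` G =
    (\bigcup_(n in [set n | forall y, mdist (q n) y <= rho n -> G y]) b n `\` N)
    `|` (if `[< G point >] then N else set0).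
  move=> oG; apply/seteqP; split => w.
    move=> /= GZ; have [Nw|nNw] := pselect (N w).
      have Zw : Z w = point by have [_] := ZP w; apply.
      right; move: GZ; rewrite Zw => Gp; case: asboolP => //.
    left; split => //; have [small _] := NP w nNw.
    have /nbhs_ballP[e /= e0 eG] : nbhs (Z w) G by exact: open_nbhs_nbhs.
    have e20 : 0 < e / 2 by rewrite divr_gt0.
    have [n ne bn] := small _ e20; exists n => //= y qy; apply: eG.
    rewrite ballEmdist/=; have := metric_triangle (Z w) (q n) y.
    by have := ZoutN w nNw n bn; rewrite (metric_sym (Z w) (q n)); lra.
  move=> [[[n /= nG bn] nNw]|]; first by apply: nG; exact: ZoutN.
  by case: asboolP => // Gp Nw /=; have [_ ->] := ZP w.
have mZo (G : set S) : open G -> measurable (Z @^-1` G).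
  move=> oG; rewrite Zopen//; apply: measurableU.
    by apply: measurableD => //; apply: bigcup_measurable => n _; exact: mb.
  by case: ifP => _ //; exact: measurable0.
have mZ : measurable_fun setT (Z : Omega -> borelType S).
  apply: (@measurability _ _ Omega (borelType S) setT Z (@open S)) =>
    // _ [G oG <-]; rewrite setTI; exact: mZo.
have mZA (A : set (borelType S)) : measurable A -> measurable (Z @^-1` A).
  by move=> mA; rewrite -[X in measurable X]setTI; exact: mZ.
have mo (G : set S) : open G -> measurable (G : set (borelType S)).
  by move=> oG; exact: sub_sigma_algebra.
have thick (F : set S) (r : R) : 0 < r ->
    measurable (Z @^-1` F) ->
    pr P (Z @^-1` F) <=
    pr mu (\bigcup_(y in F) [set x | mdist y x < 2 * r] : set (borelType S)).
  move=> r0 mF; set Q := \bigcup_(y in F) _; pose J : pred nat := fun n =>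
    `[< rho n < r /\ exists2 y, F y & mdist (q n) y <= rho n >].
  have mQ : measurable (Q : set (borelType S)).
    by apply: mo; apply: bigcup_open => y _; exact: ball_open.
  have bQ : pr P (\bigcup_(n in [set n | J n]) b n) <= pr mu Q.
    apply: (pr_bigcup_bits_le (mu := mu) psi01 mpsi mb b_weight (J := J) mQ) => n x.
    (* both [y] and the support of the weight are within [rho n] of [q n] *)
    move=> /asboolP[nr [y Fy qy]] nQ; apply: psi_out; rewrite leNgt; apply/negP.
    move=> qx; apply: nQ; exists y => //=.
    by have := metric_triangle y (q n) x; rewrite (metric_sym y (q n)); lra.
  apply: le_trans bQ.
  have mU : measurable (\bigcup_(n in [set n | J n]) b n).
    by apply: bigcup_measurable => n _; exact: mb.
  rewrite -[leRHS]addr0 -N0; apply: le_trans (prU_le _ _ _) => //.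
  apply: le_pr => //; first exact: measurableU.
  move=> w Fw; have [Nw|nNw] := pselect (N w); [by right|left].
  have [small _] := NP w nNw; have [n nr bn] := small _ r0.
  exists n => //; apply/asboolP; split => //; exists (Z w) => //.
  exact: ZoutN.
have le_closed (F : set S) : closed F ->
    pr P (Z @^-1` F) <= pr mu (F : set (borelType S)).
  move=> cF.
  have mF : measurable (F : set (borelType S)).
    by rewrite -(setCK F); apply: measurableC; apply: mo; exact: closed_openC.
  pose Q k : set (borelType S) := \bigcup_(y in F) [set x | mdist y x < 2 * k.+1%:R^-1].
  have mQ k : measurable (Q k).
    by apply: mo; apply: bigcup_open => y _; exact: ball_open.
  have ZQ k : pr P (Z @^-1` F) <= pr mu (Q k).
    have k0 : 0 < k.+1%:R^-1 :> R by rewrite invr_gt0.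
    exact: (thick F _ k0 (mZA _ mF)).
  have QF : \bigcup_k ~` Q k = ~` F.
    apply/seteqP; split => x.
      move=> [k _ nQ] Fx; apply: nQ; exists x => //=.
      by rewrite mdistxx mulr_gt0// invr_gt0.
    move=> nF; have /nbhs_ballP[e /= e0 eF] : nbhs x (~` F).
      by apply: open_nbhs_nbhs; split => //; exact: closed_openC.
    have e20 : 0 < e / 2 by rewrite divr_gt0.
    have [k _ /(_ k (leqnn _))/= ke] := near_infty_natSinv_lt (PosNum e20).
    exists k => // -[y Fy /= yx]; apply: (eF y) => //.
    rewrite ballEmdist/= metric_sym; apply: lt_trans yx _.
    have {}ke : k.+1%:R^-1 < e / 2 := ke.
    by move: (k.+1%:R^-1) ke => r; lra.
  have : pr mu (\bigcup_k ~` Q k) <= 1 - pr P (Z @^-1` F).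
    apply: pr_bigcup_le => [k||k].
    - by apply: measurableC.
    - apply/nondecreasing_seqP => k; apply/subsetPset => x; apply: contra_not.
      move=> [y Fy /= yx]; exists y => //=; apply: lt_le_trans yx _.
      by rewrite ler_pM2l// lef_pV2 ?posrE// ler_nat.
    - by rewrite pr_setC// lerD2l lerN2.
  by rewrite QF pr_setC//; lra.
have ge_open (G : set S) : open G ->
    pr mu (G : set (borelType S)) <= pr P (Z @^-1` G).
  move=> oG; have := le_closed _ (open_closedC oG).
  rewrite preimage_setC !pr_setC; [lra|exact: mo|exact: mZo].
have le_open (G : set S) : open G ->
    pr P (Z @^-1` G) <= pr mu (G : set (borelType S)).
  move=> oG.
  pose F k : set S := ~` \bigcup_(y in ~` G) [set x | mdist y x < k.+1%:R^-1].
  have cF k : closed (F k).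
    by apply: open_closedC; apply: bigcup_open => y _; exact: ball_open.
  have mF k : measurable (F k : set (borelType S)).
    by rewrite -(setCK (F k)); apply: measurableC; apply: mo; exact: closed_openC.
  have FG k : F k `<=` G.
    move=> x nU; apply: contrapT => nG; apply: nU; exists x => //=.
    by rewrite mdistxx invr_gt0.
  have GF : Z @^-1` G = \bigcup_k Z @^-1` F k.
    apply/seteqP; split => w; last by move=> [k _ /= /FG].
    move=> GZ; have /nbhs_ballP[e /= e0 eG] : nbhs (Z w) G.
      exact: open_nbhs_nbhs.
    have [k _ /(_ k (leqnn _))/= ke] := near_infty_natSinv_lt (PosNum e0).
    exists k => // -[y nGy /= yx]; apply: nGy; apply: eG.
    by rewrite ballEmdist/= metric_sym; exact: lt_trans ke.
  rewrite GF; apply: pr_bigcup_le => [k||k].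
  - exact: mZA.
  - apply/nondecreasing_seqP => k; apply/subsetPset => w; apply: contra_not.
    move=> [y Fy /= yx]; exists y => //=; apply: lt_le_trans yx _.
    by rewrite lef_pV2 ?posrE// ler_nat.
  - apply: le_trans (le_closed _ (cF k)) _; apply: le_pr => //; exact: mo.
exists Z; split => //.
  by exists N; split => // w nNw; split; [exact: NP|exact: ZoutN].
move=> A mA.
pose Zm : {mfun Omega >-> borelType S} := mfun_Sub (mem_set mZ).
suff : distribution P Zm A = mu A by rewrite /pr => <-.
apply: (@measure_unique _ _ (borelType S) (@open S) (fun=> setT)) => //.
- exact: openI.
- by move=> _; exact: openT.
- by apply/seteqP; split => // x _; exists 0%N.
- move=> G oG; apply: (etrans (prE P (mZo _ oG))).
  apply: etrans (esym (prE mu (mo _ oG))); congr EFin.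
  by apply/eqP; rewrite eq_le le_open// ge_open.
- move=> _; apply: (le_lt_trans (probability_le1 (distribution P Zm) measurableT)).
  by rewrite ltry.
Qed.

End decode.

(** * Lifting a path of laws *)

Section lift.
Context (R : realType) (S : completeSeparableMetricType R).
Context d (Omega : measurableType d) (P : probability Omega R).
Hypothesis P_nonatomic : nonatomic P.
Context (T : topologicalType) (beta : T -> borel_probability R S).
Hypothesis beta_continuous : continuous beta.
Variables (tau : T -> R) (t0 t1 : T).
Hypotheses (tau_continuous : continuous tau)
  (tau01 : forall t, 0 <= tau t <= 1) (tau0 : tau t0 = 0) (tau1 : tau t1 = 1)
  (beta0 : forall t, tau t = 0 -> beta t = beta t0)
  (beta1 : forall t, tau t = 1 -> beta t = beta t1).
Variables X0 X1 : Omega -> S.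
Hypotheses (mX0 : measurable_fun setT (X0 : Omega -> borelType S))
  (mX1 : measurable_fun setT (X1 : Omega -> borelType S))
  (law_X0 : forall A : set (borelType S), measurable A ->
    pr P (X0 @^-1` A) = pr (beta t0 : probability (borelType S) R) A)
  (law_X1 : forall A : set (borelType S), measurable A ->
    pr P (X1 @^-1` A) = pr (beta t1 : probability (borelType S) R) A).

Let kappa t := tau t * (1 - tau t).

Let kappa_ge0 t : 0 <= kappa t.
Proof. by have /andP[h0 h1] := tau01 t; rewrite mulr_ge0// subr_ge0. Qed.

Let kappa_le t : kappa t <= 1 / 2.
Proof. by have := sqr_ge0 (tau t - 1 / 2); rewrite /kappa expr2; lra. Qed.

Let kappa_continuous : continuous kappa.
Proof.
move=> t; apply: cvgM; first exact: tau_continuous.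
by apply: cvgB; [exact: cvg_cst|exact: tau_continuous].
Qed.

Let near_bits (B : nat -> T -> set Omega) t m (c : R) :
  (forall n, set_path P (B n)) -> 0 < c ->
  \forall s \near t, pr P (\big[setU/set0]_(n < m) (B n s `+` B n t)) < c.
Proof.
move=> pB; elim: m c => [|m IH] c c0.
  by apply: nearW => s; rewrite big_ord0 pr_set0.
have c20 : 0 < c / 2 by rewrite divr_gt0.
have hm := IH _ c20; have [mB cB] := pB m; have hB := cB t _ c20.
have mY n s : measurable (B n s `+` B n t).
  have [mBn _] := pB n; have mBs := mBn s; have mBt := mBn t.
  by rewrite /setY; measset.
near=> s; rewrite big_ord_recr /=.
apply: le_lt_trans (prU_le _ _ _) _ => //.
  by apply: bigsetU_measurable => i _; exact: mY.
have : pr P (\big[setU/set0]_(n < m) (B n s `+` B n t)) < c / 2 by near: s.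
have : pr P (B m s `+` B m t) < c / 2 by near: s.
lra.
Unshelve. all: by end_near. Qed.

(** The parameter [kappa] of the softened indicators vanishes only where the
    law is one of the two at the end points, for which the boundaries of the balls
    are negligible. For the continuity of [Z], finitely many bits suffice to select a
    small ball with a probability close to [1], and these bits rarely change
    between two close parameters. *)
Lemma lift_path : exists Z : T -> Omega -> S,
  [/\ forall t, measurable_fun setT (Z t : Omega -> borelType S),
      forall t (A : set (borelType S)), measurable A ->
        pr P (Z t @^-1` A) = pr (beta t : probability (borelType S) R) A,
      forall t (e : R), 0 < e -> \forall s \near t, exists N,
        [/\ measurable N, pr P N < e &
            forall w, ~ N w -> mdist (Z t w) (Z s w) < e] &
      (exists N, [/\ measurable N, pr P N = 0 &
        forall w, ~ N w -> Z t0 w = X0 w]) /\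
      (exists N, [/\ measurable N, pr P N = 0 &
        forall w, ~ N w -> Z t1 w = X1 w])].
Proof.
have [q [rho [rho_gt0 netP null]]] := negligible_net
  (beta t0 : probability (borelType S) R) (beta t1 : probability (borelType S) R).
pose v n x := 1 - mdist (q n) x / rho n.
have cv n : continuous (v n).
  move=> x; apply: cvgB; first exact: cvg_cst.
  by apply: cvgM; [exact: mdist_continuous|exact: cvg_cst].
have v_gt0 n x : (0 < v n x) = (mdist (q n) x < rho n).
  by rewrite subr_gt0 ltr_pdivrMr// mul1r.
have v_eq0 n : [set x | v n x = 0] = [set x | mdist (q n) x = rho n].
  apply/seteqP; split => x /=; rewrite /v.
    move=> /eqP; rewrite subr_eq0 => /eqP h.
    by rewrite -[RHS]mul1r h divfK// gt_eqF.
  by move=> ->; rewrite divff ?subrr// gt_eqF.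
pose psi t n x := soft_indic (kappa t) (v n x).
have psi_out t n x : rho n <= mdist (q n) x -> psi t n x = 0.
  by move=> h; apply: soft_indic_le0; rewrite leNgt v_gt0 -leNgt.
have psi_in t n x : mdist (q n) x < rho n / 2 -> psi t n x = 1.
  move=> h; have v2 : 1 / 2 < v n x.
    rewrite /v ltrBrDl -ltrBrDr ltr_pdivrMr//; lra.
  by apply: soft_indic_eq1; have := kappa_ge0 t; have := kappa_le t; lra.
have kappa0 t : kappa t = 0 -> tau t = 0 \/ tau t = 1.
  move=> /eqP; rewrite mulf_eq0 subr_eq0 => /orP[/eqP|/eqP <-]; tauto.
have ac n : almost_continuous beta (fun t => psi t n).
  apply: soft_indic_almost_continuous => // t /kappa0[/beta0|/beta1] ->;
  by rewrite v_eq0; have [] := null n.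
have acw s : almost_continuous beta (fun t => weight (psi t) s).
  elim: s => [|b s IH]; first exact: almost_continuous1.
  by case: b; apply: almost_continuousM => //; exact: almost_continuousC.
have psi01 t n x : 0 <= psi t n x <= 1 by exact: soft_indic_ge0_le1.
have mpsi t n : measurable_fun (setT : set (borelType S)) (psi t n).
  by have [m _ _] := ac n; exact: m.
pose w s t := \int[(beta t : probability (borelType S) R)]_x weight (psi t) s x.
pose V n : set (borelType S) := [set x | mdist (q n) x < rho n].
have mV n : measurable (V n).
  have -> : V n = mdist (q n) @^-1` `]-oo, rho n[%classic.
    by apply/seteqP; split => y; rewrite /= in_itv.
  rewrite -[Y in measurable Y]setTI.
  have mq := continuous_borel_measurable (@mdist_continuous _ _ (q n)).
  by apply: mq; [exact: measurableT|exact: measurable_itv].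
have cell_preimage X s : cell (fun n => X @^-1` V n) s = X @^-1` cell V s.
  by elim: s => [//|[] s IH] /=; rewrite IH.
have law_cell t X : kappa t = 0 ->
    (forall A : set (borelType S), measurable A ->
      pr P (X @^-1` A) = pr (beta t : probability (borelType S) R) A) ->
    forall s, pr P (cell (fun n => X @^-1` V n) s) = w s t.
  move=> kt lawX s; rewrite cell_preimage lawX; last exact: cell_measurable.
  rewrite -integral_pr; last exact: cell_measurable.
  congr fine; apply: eq_integral => x _; congr EFin.
  have psiE n : psi t n x = \1_(V n) x.
    rewrite /psi kt soft_indic0 v_gt0 indicE; congr (_%:R); congr nat_of_bool.
    by apply/idP/idP; rewrite inE.
  elim: s => [|b s IH] /=; first by rewrite indicT.
  rewrite -IH psiE indicI; congr (_ * _); case: b => //.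
  by rewrite !indicE in_setC; case: (x \in _); rewrite ?subrr ?subr0.
have mE X n : measurable_fun setT (X : Omega -> borelType S) ->
    measurable (X @^-1` V n).
  by move=> mX; rewrite -[Y in measurable Y]setTI; exact: mX.
have k0 : kappa t0 = 0 by rewrite /kappa tau0 mul0r.
have k1 : kappa t1 = 0 by rewrite /kappa tau1 subrr mulr0.
have w_cons s t : w (true :: s) t + w (false :: s) t = w s t.
  have bw s' : bounded_measurable (weight (psi t) s' : borelType S -> R).
    exact: (almost_continuous_bounded t (acw s')).
  rewrite /w -integral_boundedD//.
  by congr fine; apply: eq_integral => x _; congr EFin => /=; ring.
have w_ge0 s t : 0 <= w s t.
  by apply: Rintegral_ge0 => x _; have [_ h _] := acw s; have /andP[] := h t x.
have w_nil t : w [::] t = 1 by exact: integral_probability_cst.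
have cw s : continuous (w s).
  exact: (almost_continuous_expectation beta_continuous (acw s)).
have [B [pB Bw B0 B1]] := bits_ex P_nonatomic cw w_nil w_ge0 w_cons
  tau_continuous tau01 tau0 tau1 (fun n => mE X0 n mX0) (fun n => mE X1 n mX1)
  (law_cell t0 X0 k0 law_X0) (law_cell t1 X1 k1 law_X1).
have mB n t : measurable (B n t) by have [mBn _] := pB n.
have /choice[Z ZP] t := decode_ex rho_gt0 netP (psi01 t) (mpsi t)
  (psi_out t) (psi_in t) (fun n => mB n t) (fun s => Bw s t).
have endpoint t X : (forall n, pr P (B n t `+` (X @^-1` V n)) = 0) ->
    measurable_fun setT (X : Omega -> borelType S) ->
    exists N, [/\ measurable N, pr P N = 0 & forall x, ~ N x -> Z t x = X x].
  move=> BX mX; have [_ [N [mN N0 NP]] _] := ZP t.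
  pose M := \bigcup_n (B n t `+` (X @^-1` V n)).
  have mY n : measurable (B n t `+` (X @^-1` V n)).
    by have mBt := mB n t; have mXV := mE X n mX; rewrite /setY; measset.
  have mM : measurable M by exact: bigcupT_measurable.
  have M0 : pr P M = 0 by exact: pr_bigcup0.
  exists (N `|` M); split; first exact: measurableU.
    apply/eqP; rewrite eq_le pr_ge0 andbT -(addr0 0) -{1}N0 -M0.
    exact: prU_le.
  move=> x /not_orP[nN nM]; have [dx Zx] := NP x nN.
  apply: (decodes_uniq dx Zx) => n Bn; apply: ltW.
  by apply: contrapT => nV; apply: nM; exists n => //; left.
exists Z; split.
- by move=> t; have [] := ZP t.
- by move=> t; have [] := ZP t.
- move=> t e e0; have e20 : 0 < e / 2 by rewrite divr_gt0.
  pose J : pred nat := fun n => rho n < e / 2.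
  have psi1 x : exists2 n, J n & psi t n x = 1.
    by have [n [ne nx]] := netP x _ e20; exists n => //; exact: psi_in.
  have [m Um] := pr_bigcup_bits_gt
    (mu := (beta t : probability (borelType S) R)) (psi01 t) (mpsi t) (fun n => mB n t)
    (fun s => Bw s t) e20 psi1.
  set U := \bigcup_(n in _) _ in Um.
  have mU : measurable U by apply: bigcup_measurable => n _; exact: mB.
  have near_B := near_bits t m pB e20.
  near=> s.
  have Ds : pr P (\big[setU/set0]_(n < m) (B n s `+` B n t)) < e / 2.
    by near: s.
  set D := \big[setU/set0]_(n < m) _ in Ds.
  have [_ [N [mN N0 NP]] _] := ZP t; have [_ [N' [mN' N'0 N'P]] _] := ZP s.
  have mD : measurable D.
    apply: bigsetU_measurable => n _; have := mB n s; have := mB n t => ? ?.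
    by rewrite /setY; measset.
  exists (N `|` N' `|` (~` U `|` D)); split; first by measset.
    apply: le_lt_trans (prU_le _ _ _) _; try by measset.
    have h1 : pr P (N `|` N') <= 0.
      by rewrite -(addr0 0) -{1}N0 -N'0; exact: prU_le.
    have h2 : pr P (~` U `|` D) <= pr P (~` U) + pr P D.
      by apply: prU_le; measset.
    by rewrite pr_setC// in h2; lra.
  move=> x /not_orP[/not_orP[nN nN'] /not_orP[/contrapT[n /= /andP[nm Jn] Bt] nD]].
  have Bs : B n s x.
    apply: contrapT => nBs; apply: nD.
    rewrite /D -(bigcup_mkord m (fun n => B n s `+` B n t)).
    by exists n => //; right.
  have [_ Zt] := NP x nN; have [_ Zs] := N'P x nN'.
  have := Zt n Bt; have := Zs n Bs; have := metric_triangle (Z t x) (q n) (Z s x).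
  by rewrite (metric_sym (Z t x) (q n)); move: Jn; rewrite /J; lra.
- by split; exact: endpoint.
Unshelve. all: by end_near. Qed.

End lift.

(** * Random variables modulo almost sure equality *)

Section L0.
Context d (Omega : measurableType d) (R : realType) (P : probability Omega R)
  (S : completeSeparableMetricType R).
Local Notation classL0 := (\pi_({mfun_ P, Omega >-> borelType S})%qT).

Lemma representative_ae (f : {mfun Omega >-> borelType S}) :
  exists N, [/\ measurable N, pr P N = 0 &
    forall w, ~ N w -> representative (classL0 f : L0 P S) w = f w].
Proof.
have [N [mN N0 XfN]] : representative (classL0 f : L0 P S) = f %[ae P].
  have /eqmodP/asboolP// : (representative (classL0 f : L0 P S) =
    f %[mod {mfun_ P, Omega >-> borelType S}])%qT.
  by rewrite reprK.
exists N; split => //; first by rewrite /pr N0.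
by move=> w Nw; apply: contrapT => ne; apply/Nw/XfN => /(_ I).
Qed.

Lemma L0_eq (f : {mfun Omega >-> borelType S}) (X : L0 P S) :
  (exists N, [/\ measurable N, pr P N = 0 &
    forall w, ~ N w -> f w = representative X w]) -> classL0 f = X.
Proof.
move=> [N [mN N0 fX]]; rewrite -[X]reprK; apply/eqmodP/asboolP.
exists N; split => //; first by apply: (etrans (prE P mN)); rewrite N0.
by move=> w /= fXw; apply: contrapT => /fX fE; apply: fXw => _; exact: fE.
Qed.

Lemma L0_dist_le (f g : {mfun Omega >-> borelType S}) (e : R) : 0 < e ->
  (exists N, [/\ measurable N, pr P N < e &
    forall w, ~ N w -> mdist (f w : S) (g w) < e]) ->
  mdist (classL0 f : L0 P S) (classL0 g) <= e.
Proof.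
move=> e0 [N [mN Ne fg]].
have [Nf [mNf Nf0 fE]] := representative_ae f.
have [Ng [mNg Ng0 gE]] := representative_ae g.
apply: ge_inf; first by exists 0 => r [/ltW].
have mD := measurable_dist_ge (representative (classL0 f : L0 P S))
  (representative (classL0 g : L0 P S)) e.
split => //; rewrite prE// lee_fin.
apply: (@le_trans _ _ (pr P (N `|` (Nf `|` Ng)))).
  apply: le_pr => //; first by measset.
  move=> w; rewrite /dist_ge/= => h; have [Nw|nN] := pselect (N w); first by left.
  right; apply: contrapT => /not_orP[nf ng].
  by move: h; rewrite fE// gE// leNgt => /negP; apply; exact: fg.
apply: le_trans (prU_le _ _ _) _; [by []|by measset|].
have : pr P (Nf `|` Ng) <= 0 by rewrite -(addr0 0) -{1}Nf0 -Ng0; exact: prU_le.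
lra.
Qed.

End L0.

Lemma clamp_continuous (R : realType) :
  continuous (fun t : R => Num.max 0 (Num.min 1 t)).
Proof.
move=> t; have cmin : Num.min 1 s @[s --> t] --> Num.min 1 t.
  exact: (@continuous_min _ _ (fun=> 1) id t (@cst_continuous _ _ _ _) (@cvg_id _ _)).
have := @continuous_max R R (fun=> 0) (fun s => Num.min 1 s) t.
move=> /(_ (@cst_continuous _ _ _ _) cmin); exact.
Qed.

Lemma clamp01 (R : realType) (t : R) : 0 <= Num.max 0 (Num.min 1 t) <= 1.
Proof. by rewrite le_max lexx/= ge_max ler01 ge_min lexx. Qed.

Lemma clamp_id (R : realType) (t : R) : 0 <= t <= 1 ->
  Num.max 0 (Num.min 1 t) = t.
Proof. by move=> /andP[t0 t1]; rewrite min_r// max_r. Qed.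

(** Extending a path constantly beyond its end points frees its continuity from
    relative neighbourhoods. *)
Lemma continuous_clamp (R : realType) (Y : topologicalType) (f : R -> Y) :
  {within `[0, 1], continuous f} ->
  continuous (fun t : R => f (Num.max 0 (Num.min 1 t))).
Proof.
move=> cf t U fU; set c := Num.max 0 (Num.min 1 t).
have c01 : `[0, 1]%classic c by rewrite /= in_itv/=; exact: clamp01.
have near_c : within `[0, 1]%classic (nbhs c) (f @^-1` U).
  by rewrite (nbhs_subspace_in c01); exact: cf.
have near_t : \forall s \near t, `[0, 1]%classic (Num.max 0 (Num.min 1 s)) ->
    U (f (Num.max 0 (Num.min 1 s))) by exact: (@clamp_continuous R t _ near_c).
move: near_t; apply: filterS => s; apply.
by rewrite /= in_itv/=; exact: clamp01.
Qed.

Theorem theorem2 (R : realType) (S : completeSeparableMetricType R)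
    (d : measure_display) (Omega : measurableType d) (P : probability Omega R)
    (P_complete : measure_is_complete P) (P_nonatomic : nonatomic P)
    (alpha : R -> borel_probability R S)
    (alpha_continuous : {within `[0, 1], continuous alpha})
    (X_mu X_nu : L0 P S)
    (law_X_mu : law X_mu ≡μ alpha 0) (law_X_nu : law X_nu ≡μ alpha 1) :
  exists hat_alpha : R -> L0 P S,
    [/\ {within `[0, 1], continuous hat_alpha},
        hat_alpha 0 = X_mu,
        hat_alpha 1 = X_nu
      & forall t : R, t \in `[0, 1] -> law (hat_alpha t) ≡μ alpha t].
Proof.
pose tau (t : R) : R := Num.max 0 (Num.min 1 t).
have tau0 : tau 0 = 0 by apply: clamp_id; rewrite lexx ler01.
have tau1 : tau 1 = 1 by apply: clamp_id; rewrite lexx ler01.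
pose beta t := alpha (tau t).
have beta0 : beta 0 = alpha 0 by rewrite /beta tau0.
have beta1 : beta 1 = alpha 1 by rewrite /beta tau1.
have betaE (s t : R) : tau s = t -> tau t = t -> beta s = beta t.
  by move=> st tt; rewrite /beta st tt.
have law_pr (X : L0 P S) (m : borel_probability R S) : law X ≡μ m ->
    forall A : set (borelType S), measurable A ->
    pr P (representative X @^-1` A) = pr (m : probability (borelType S) R) A.
  by move=> Xm A mA; have := Xm A mA; rewrite /pr => <-.
rewrite -beta0 in law_X_mu; rewrite -beta1 in law_X_nu.
have mX (X : L0 P S) : measurable_fun setT (representative X).
  exact: measurable_funP.
have [Z [mZ lawZ cZ [Z0 Z1]]] := lift_path P_nonatomic
  (continuous_clamp alpha_continuous : continuous beta)
  (@clamp_continuous R) (@clamp01 R) tau0 tau1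
  (fun t tt => betaE t 0 tt tau0) (fun t tt => betaE t 1 tt tau1)
  (mX X_mu) (mX X_nu) (law_pr _ _ law_X_mu) (law_pr _ _ law_X_nu).
pose f t : {mfun Omega >-> borelType S} := mfun_Sub (mem_set (mZ t)).
exists (fun t => (\pi_({mfun_ P, Omega >-> borelType S}) (f t))%qT); split.
- apply: continuous_subspaceT => t; apply/cvg_ballP => e e0.
  have e20 : 0 < e / 2 by rewrite divr_gt0.
  have := cZ t _ e20; apply: filterS => s near_s.
  rewrite ballEmdist/=; apply: (@le_lt_trans _ _ (e / 2)); last by lra.
  exact: L0_dist_le.
- exact: L0_eq.
- exact: L0_eq.
- move=> t; rewrite in_itv/= => t01 A mA; apply: (etrans (lawE P (f t) mA)).
  have mZA : measurable (Z t @^-1` A).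
    by rewrite -[Y in measurable Y]setTI; exact: (mZ t).
  apply: (etrans (prE P mZA)); rewrite lawZ// /beta /tau clamp_id//.
  exact/esym/prE.
Qed.
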